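(* Let $G$ be a finite connected graph on the vertex set $[n]$ without isolated vertices, and suppose that its complementary graph $G^c$ is chordal. Let $K$ be a field, $S=K[x_1,\ldots,x_n]$, and $\mathbf{a}=(a_1,\ldots,a_n)\in\mathbb{Z}_{>0}^n$. Then the ideal $I(G)^{[\mathbf{a}]}$ is componentwise linear if and only if at least one of the following holds: (A) At most one component of $\mathbf{a}$ is bigger than one. (B) The set $\mathcal{A}:=\{i\in[n] : a_i\ge 2\}$ is an independent set of $G$, and $N_G(i)\cap N_G(j)=\emptyset$ for any distinct $i,j\in\mathcal{A}$. (C) Exactly two components $a_i$ and $a_j$ of $\mathbf{a}$ are bigger than one and, for these, (i) $\{i,j\}\in E(G)$, (ii) $N_G(i)\cap N_G(j)=\emptyset$, and (iii) every vertex belonging to $N_G(i)$ is adjacent to every vertex belonging to $N_G(j)$.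
   Context: Graphs are finite, with no loops, no multiple edges and no isolated vertices (the complementary graph $G^c$ may have isolated vertices). $V(G)=[n]=\{1,\ldots,n\}$ is the vertex set and $E(G)$ the edge set of $G$; $i$ is adjacent to $j$ if $\{i,j\}\in E(G)$; $N_G(i)=\{j\in V(G) : \{i,j\}\in E(G)\}$. The complementary graph $G^c$ has vertex set $[n]$ and edges the pairs $\{i,j\}$, $i\neq j$, with $\{i,j\}\notin E(G)$. A graph is chordal if every cycle of length at least $4$ has a chord. An independent set of $G$ is a subset $\mathcal{A}\subset V(G)$ such that $\{i,j\}\notin E(G)$ for all $i,j\in\mathcal{A}$ with $i\ne j$. $S=K[x_1,\ldots,x_n]$ is the polynomial ring over a field $K$ with $\deg x_1=\cdots=\deg x_n=1$. The edge ideal $I(G)$ is the ideal of $S$ generated by the monomials $x_ix_j$ with $\{i,j\}\in E(G)$. For a monomial ideal $I$, $G(I)$ denotes its unique minimal set of monomial generators. For a squarefree monomial $u=x_{i_1}\cdots x_{i_d}$ with $1\le i_1<\cdots<i_d\le n$, set $u^{[\mathbf{a}]}:=x_{i_1}^{a_{i_1}}\cdots x_{i_d}^{a_{i_d}}$; for a squarefree monomial ideal $I$, $I^{[\mathbf{a}]}$ is the monomial ideal with $G(I^{[\mathbf{a}]})=\{u^{[\mathbf{a}]} : u\in G(I)\}$. Thus $I(G)^{[\mathbf{a}]}$ is generated by the monomials $x_i^{a_i}x_j^{a_j}$ with $\{i,j\}\in E(G)$. For a homogeneous ideal $I$ of $S$ and an integer $j$, $I_{\langle j\rangle}$ denotes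 the ideal generated by all homogeneous polynomials of degree $j$ belonging to $I$. The ideal $I$ is componentwise linear if $I_{\langle j\rangle}$ has a linear resolution for all $j$ (with the usual convention that the zero ideal has a linear resolution). An ideal $L$ generated by homogeneous elements of a single degree $d$ has a linear resolution if $\beta_{p,q}(L)=\dim_K \operatorname{Tor}_p^S(K,L)_q=0$ whenever $q\ne p+d$. *)

(* Defs.v *)
From HB Require Import structures.
From mathcomp Require Import all_boot all_order all_algebra ring.
From mathcomp Require Export mpoly.

Set Implicit Arguments.
Unset Strict Implicit.
Unset Printing Implicit Defensive.

Import GRing.Theory.
Local Open Scope ring_scope.

(** * Graphs: a symmetric irreflexive relation on ['I_n] *)

Section Graphs.
Variables (T : finType) (e : rel T).

Definition nbhd (i : T) : {set T} := [set j | e i j].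

Definition compl_graph : rel T := [rel i j | (i != j) && ~~ e i j].

Definition independent (A : {set T}) : Prop :=
  forall i j, i \in A -> j \in A -> i != j -> ~~ e i j.

(* [c] lists the vertices of a cycle without repetition; a chord is an edge
   between two vertices that are not cyclically consecutive in [c]. *)
Definition chordal : Prop :=
  forall c : seq T, (4 <= size c)%N -> ucycle e c ->
  exists x y, [/\ x \in c, y \in c, e x y, y != next c x & x != next c y].

Definition connected : Prop := forall i j, connect e i j.

End Graphs.

(** * Ideals of [{mpoly K[n]}], as [Prop]-valued predicates *)

Section Ideals.
Variables (K : fieldType) (n : nat).
Notation S := {mpoly K[n]}.
Implicit Types (I X : S -> Prop) (m u : 'X_{1..n}).

Definition ideal_gen X : S -> Prop := fun f =>
  exists r (c g : 'I_r -> S),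
    (forall k, X (g k)) /\ f = \sum_(k < r) c k * g k.

Definition edge_ideal (e : rel 'I_n) : S -> Prop :=
  ideal_gen (fun f => exists i j, e i j /\ f = 'X_i * 'X_j).

(* G(I): the minimal monomials of I for divisibility. *)
Definition min_gens I : 'X_{1..n} -> Prop := fun u =>
  I 'X_[u] /\ forall m, I 'X_[m] -> (m <= u)%MM -> m = u.

(* For a squarefree [u] the exponents are 0 or 1, so that this is the product
   of the x_i^(a i) over the x_i dividing [u]. *)
Definition mnm_bracket (a : 'I_n -> nat) u : 'X_{1..n} :=
  [multinom (a i * u i)%N | i < n].

Definition ideal_bracket (a : 'I_n -> nat) I : S -> Prop :=
  ideal_gen (fun f => exists u, min_gens I u /\ f = 'X_[mnm_bracket a u]).

Definition degree_component I (j : nat) : S -> Prop :=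
  ideal_gen (fun f => I f /\ f \is j.-homog).

Definition generated_in_degree (d : nat) I : Prop :=
  exists2 X, (forall f, X f -> f \is d.-homog) & (forall f, I f <-> ideal_gen X f).

End Ideals.

Arguments edge_ideal K [n] e _.

(** * Graded free resolutions of K and Tor *)

Section Tor.
Variables (K : fieldType) (n : nat).
Notation S := {mpoly K[n]}.

(* F_p is the free S-module on [fbasis p], with [b] in degree [fdeg b], and
   d : F_(p+1) -> F_p sends the basis element [c] to \sum_b fdiff c b * b. *)
Record free_complex := FreeComplex {
  fbasis : nat -> finType;
  fdeg : forall p, fbasis p -> nat;
  fdiff : forall p, fbasis p.+1 -> fbasis p -> S
}.
Arguments fdeg F [p] b : rename.
Arguments fdiff F [p] c b : rename.

(* [f] is homogeneous of degree q - s, an integer that may be negative. *)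
Definition shift_homog (s q : nat) (f : S) : bool :=
  if (s <= q)%N then f \is (q - s).-homog else f == 0.

Section Complex.
Variable F : free_complex.

Notation chains p := {ffun fbasis F p -> S}.

Definition diff p (v : chains p.+1) : chains p :=
  [ffun b => \sum_c v c * fdiff F c b].

(* K is an S-module through [f . c = f(0) c]. *)
Definition augmentation (eps : fbasis F 0 -> K) (v : chains 0) : K :=
  \sum_b (v b)@_0%MM * eps b.

Record free_resolution_of_K (eps : fbasis F 0 -> K) : Prop := {
  fres_diff_deg : forall p (c : fbasis F p.+1) (b : fbasis F p),
    shift_homog (fdeg F b) (fdeg F c) (fdiff F c b);
  fres_aug_deg : forall b, fdeg F b <> 0%N -> eps b = 0;
  fres_aug_surj : forall x, exists v, augmentation eps v = x;
  fres_exact0 : forall v : chains 0,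
    augmentation eps v = 0 <-> exists w, diff w = v;
  fres_exact : forall p (v : chains p.+1),
    diff v = 0 <-> exists w, diff w = v
}.

(* The complex F (x) L for an ideal L: since F_p is free, F_p (x) L is the
   set of chains with coefficients in L. *)
Variable L : S -> Prop.

Definition tensor_chain p (q : nat) (v : chains p) : Prop :=
  forall b, L (v b) /\ shift_homog (fdeg F b) q (v b).

Definition tensor_cycle p (q : nat) : chains p -> Prop :=
  match p return chains p -> Prop with
  | 0 => fun v => tensor_chain q v
  | p'.+1 => fun v => tensor_chain q v /\ diff v = 0
  end.

Definition tensor_boundary p (q : nat) (v : chains p) : Prop :=
  exists w : chains p.+1, tensor_chain q w /\ diff w = v.

(* dim_K H_p(F (x) L)_q = r: the [z k] are cycles whose classes form a basis. *)
Definition homology_dim (p q r : nat) : Prop :=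
  exists z : 'I_r -> chains p,
  [/\ forall k, tensor_cycle q (z k),
      forall c : 'I_r -> K,
        tensor_boundary q (\sum_(k < r) c k *: z k) -> forall k, c k = 0
    & forall v, tensor_cycle q v -> exists c : 'I_r -> K,
        tensor_boundary q (v - \sum_(k < r) c k *: z k)].

End Complex.

(* The Koszul complex on x_1, ..., x_n: the basis element indexed by [A] is
   e_A, and e_A is sent to \sum_(i in A) (-1)^(#{j in A | j < i}) x_i e_(A \ i). *)
Definition kbasis (p : nat) : finType := {A : {set 'I_n} | #|A| == p}.

Definition ksign (i : 'I_n) (A : {set 'I_n}) : S :=
  (-1) ^+ #|[set j in A | (j < i)%N]|.

Definition kdiff p (A : kbasis p.+1) (B : kbasis p) : S :=
  \sum_(i in val A | val A :\ i == val B) ksign i (val A) * 'X_i.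

Definition koszul : free_complex :=
  @FreeComplex kbasis (fun p _ => p) kdiff.

Definition koszul_aug (_ : fbasis koszul 0) : K := 1.

(* beta_(p,q)(L) = r, i.e. dim_K Tor_p^S(K,L)_q = r.  Tor is computed from the
   Koszul complex, which is a free resolution of K
   ([KoszulExact.koszul_free_resolution] below). *)
Definition graded_betti (L : S -> Prop) (p q r : nat) : Prop :=
  homology_dim koszul L p q r.

(* The zero ideal has a d-linear resolution for every d. *)
Definition linear_resolution (d : nat) (L : S -> Prop) : Prop :=
  generated_in_degree d L /\
  forall p q : nat, q <> (p + d)%N -> graded_betti L p q 0.

Definition componentwise_linear (I : S -> Prop) : Prop :=
  forall j : nat, linear_resolution j (degree_component I j).

End Tor.

(** * The Koszul complex is a free resolution of K *)

Module KoszulExact.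
Section KoszulExact.
Variables (K : fieldType) (n : nat).
Notation S := {mpoly K[n]}.
Implicit Types (i j : 'I_n) (A B : {set 'I_n}) (m : 'X_{1..n}) (f g : S).

Local Notation sgn := (@ksign K n).

Lemma mcoeffMXU f i m :
  ('X_i * f)@_m = if (0 < m i)%N then f@_(m - U_(i))%MM else 0.
Proof.
case: ifP => Hm.
  have le : (U_(i) <= m)%MM.
    by apply/mnm_lepP => j; rewrite mnm1E; case: eqP => // <-.
  by rewrite -{1}(submK le) addmC mulrC mcoeffMX.
rewrite mulrC; apply/eqP; rewrite mcoeff_eq0; apply/negP.
move=> /(msuppM_le) /allpairsP [[m1 m2] /= [_ H2 E]].
move: H2; rewrite msuppX inE => /eqP E2.
by move: Hm; rewrite E E2 mnmDE mnm1E eqxx addn1.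
Qed.

(* [xdiv i f] is the g with f - x_i g free of x_i. *)
Definition xdiv i f : S :=
  \sum_(m <- msupp f | (0 < m i)%N) f@_m *: 'X_[m - U_(i)].

Lemma mcoeff_xdiv i f m : (xdiv i f)@_m = f@_(m + U_(i))%MM.
Proof.
rewrite /xdiv raddf_sum /=.
under eq_bigr => m' _ do rewrite mcoeffZ mcoeffX.
have key m' : (0 < m' i)%N -> ((m' - U_(i))%MM == m) = (m' == (m + U_(i))%MM).
  move=> H; have le : (U_(i) <= m')%MM.
    by apply/mnm_lepP => j; rewrite mnm1E; case: eqP => // <-.
  by apply/eqP/eqP => [<-|->]; rewrite ?submK // addmK.
under eq_bigr => m' H do rewrite key //.
have pos : (0 < (m + U_(i))%MM i)%N by rewrite mnmDE mnm1E eqxx addn1.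
case: (boolP ((m + U_(i))%MM \in msupp f)) => Hin.
  rewrite big_mkcond (bigD1_seq _ Hin (msupp_uniq f)) /= pos.
  rewrite eqxx mulr1 big1 ?addr0 // => m' /negbTE ->.
  by rewrite mulr0 if_same.
rewrite (memN_msupp_eq0 Hin) big_seq_cond big1 // => m' /andP[Hm' _].
case: eqP => [E|_]; last by rewrite mulr0.
by rewrite -E Hm' in Hin.
Qed.

Lemma xdivD i f g : xdiv i (f + g) = xdiv i f + xdiv i g.
Proof. by apply/mpolyP => m; rewrite mcoeffD !mcoeff_xdiv mcoeffD. Qed.

Lemma xdiv0 i : xdiv i 0 = 0.
Proof. by apply/mpolyP => m; rewrite mcoeff_xdiv !mcoeff0. Qed.

Lemma xdivN i f : xdiv i (- f) = - xdiv i f.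
Proof. by apply/mpolyP => m; rewrite mcoeffN !mcoeff_xdiv mcoeffN. Qed.

Lemma sgn_cases i A : sgn i A = 1 \/ sgn i A = -1.
Proof.
by rewrite /ksign -signr_odd; case: odd; rewrite ?expr1 ?expr0; [right|left].
Qed.

Lemma sgn_sq i A : sgn i A * sgn i A = 1.
Proof. by case: (sgn_cases i A) => ->; rewrite ?mulrNN mulr1. Qed.

Lemma xdiv_sgn i j A f : xdiv i (sgn j A * f) = sgn j A * xdiv i f.
Proof. by case: (sgn_cases j A) => ->; rewrite ?mulN1r ?xdivN ?mul1r. Qed.

Lemma xdiv_sum i (T : finType) (P : pred T) (G : T -> S) :
  xdiv i (\sum_(t | P t) G t) = \sum_(t | P t) xdiv i (G t).
Proof. exact: (big_morph _ (xdivD i) (xdiv0 i)). Qed.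

Lemma xdivX i f : xdiv i ('X_i * f) = f.
Proof.
apply/mpolyP => m; rewrite mcoeff_xdiv mcoeffMXU.
by rewrite mnmDE mnm1E eqxx addn1 /= addmK.
Qed.

Lemma xdiv_comm i j f : i != j -> xdiv i ('X_j * f) = 'X_j * xdiv i f.
Proof.
move=> nij; apply/mpolyP => m; rewrite mcoeff_xdiv !mcoeffMXU.
rewrite mnmDE mnm1E (negbTE nij) addn0; case: ifP => // Hm.
rewrite mcoeff_xdiv; congr (_@__); apply/mnmP => k.
rewrite !(mnmDE, mnmBE, mnm1E); case: (altP (j =P k)) => [<-|_].
  by rewrite (negbTE nij) !addn0.
by rewrite !subn0.
Qed.

Definition free_of i f : S := f - 'X_i * xdiv i f.

Lemma mcoeff_free_of i f m :
  (free_of i f)@_m = if (0 < m i)%N then 0 else f@_m.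
Proof.
rewrite /free_of mcoeffB mcoeffMXU; case: ifP => Hm; last by rewrite subr0.
have le : (U_(i) <= m)%MM.
  by apply/mnm_lepP => j; rewrite mnm1E; case: eqP => // <-.
by rewrite mcoeff_xdiv submK // subrr.
Qed.

Lemma sgnU1 i j A : j \notin A ->
  sgn i (j |: A) = (if (j < i)%N then -1 else 1) * sgn i A.
Proof.
move=> Hj; rewrite /ksign; case: ifP => lt.
  have -> : [set k in j |: A | (k < i)%N] = j |: [set k in A | (k < i)%N].
    apply/setP => k; rewrite !inE; case: eqP => //= ->.
    by rewrite lt.
  by rewrite cardsU1 !inE (negbTE Hj) /= add1n exprS.
have -> : [set k in j |: A | (k < i)%N] = [set k in A | (k < i)%N].
  apply/setP => k; rewrite !inE; case: eqP => //= ->.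
  by rewrite lt !andbF.
by rewrite mul1r.
Qed.

Lemma sgn_anti i j A : i != j -> i \notin A -> j \notin A ->
  sgn i A * sgn j (i |: A) = - (sgn j A * sgn i (j |: A)).
Proof.
move=> nij Hi Hj; rewrite !sgnU1 //.
have := nij; rewrite -val_eqE /= neq_ltn => /orP[] lt;
  rewrite lt ltnNge (ltnW lt) /= !(mulN1r, mul1r, mulrN, opprK); ring.
Qed.

(* Chains of all exterior degrees at once. *)
Implicit Types v w u : {set 'I_n} -> S.

Definition D v : {set 'I_n} -> S :=
  fun B => \sum_(i | i \notin B) sgn i B * ('X_i * v (i |: B)).

Definition T i v : {set 'I_n} -> S :=
  fun A => if i \in A then sgn i (A :\ i) * xdiv i (v (A :\ i)) else 0.

Definition P i v : {set 'I_n} -> S :=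
  fun B => if i \in B then 0 else free_of i (v B).

Lemma DD v B : D (D v) B = 0.
Proof.
rewrite /D.
pose G i j := sgn i B * ('X_i * (sgn j (i |: B) * ('X_j * v (j |: (i |: B))))).
transitivity (\sum_(i | i \notin B) \sum_(j | (j \notin B) && (j != i)) G i j).
  apply: eq_bigr => i Hi; rewrite !big_distrr /=; apply: eq_bigl => j.
  by rewrite !inE negb_or andbC.
rewrite (exchange_big_dep (fun j => j \notin B)) /=; last by move=> i j _ /andP[].
have anti i j : i != j -> i \notin B -> j \notin B -> G i j = - G j i.
  move=> nij Hi Hj; rewrite /G setUCA.
  have := sgn_anti nij Hi Hj; set a := sgn i B; set b := sgn j (i |: B).
  set c := sgn j B; set d := sgn i (j |: B) => E.
  set w := v _.
  transitivity ((a * b) * ('X_i * 'X_j * w)); first by ring.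
  by rewrite E; ring.
pose H i j := if (i < j)%N then G i j else 0.
transitivity (\sum_(j | j \notin B) \sum_(i | i \notin B) (H i j - H j i)).
  apply: eq_bigr => j Hj.
  rewrite [LHS](eq_bigl (fun i => (i \notin B) && (i != j))); last first.
    by move=> i; rewrite Hj eq_sym.
  rewrite [RHS](bigD1 j) //= subrr add0r; apply: eq_bigr => i /andP[Hi nij].
  rewrite /H; have := nij; rewrite -val_eqE /= neq_ltn => /orP[] lt;
    rewrite lt ltnNge (ltnW lt) /=; first by rewrite subr0.
  by rewrite sub0r anti.
under eq_bigr => j _ do rewrite sumrB.
by rewrite sumrB exchange_big subrr.
Qed.

Lemma homotopy i v B : D (T i v) B + T i (D v) B = v B - P i v B.
Proof.
rewrite /P /T /D; case: ifP => Hi; last first.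
  rewrite addr0 (bigD1 i) ?Hi //= big1 ?addr0.
    rewrite setU11 setU1K ?Hi // /free_of opprB addrC subrK.
    by rewrite mulrCA [sgn _ _ * (_ * _)]mulrA sgn_sq mul1r.
  move=> j /andP[_ nji]; rewrite !inE eq_sym (negbTE nji) Hi /=.
  by rewrite !mulr0.
set C := B :\ i.
have BE : i |: C = B by rewrite setD1K.
have niC : i \notin C by rewrite !inE eqxx.
rewrite subr0 xdiv_sum [X in _ + _ * X](bigD1 i) //= BE xdiv_sgn xdivX mulrDr mulrA sgn_sq mul1r.
rewrite addrCA -[RHS]addr0; congr (_ + _).
rewrite big_distrr /=.
rewrite [X in _ + X](eq_bigl (fun j => j \notin B)); last first.
  move=> j; rewrite -BE !inE negb_or andbC; by case: eqP.
rewrite -big_split /= big1 // => j Hj.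
have nij : i != j by apply: contraNneq Hj => <-.
have njC : j \notin C by rewrite !inE (negbTE Hj) andbF.
rewrite !inE Hi orbT.
have -> : (j |: B) :\ i = j |: C.
  by apply/setP => k; rewrite !inE; case: (altP (k =P i)) => [->|]; rewrite ?(negbTE nij).
rewrite xdiv_sgn xdiv_comm // -BE.
have := sgn_anti nij niC njC; set a := sgn i C; set b := sgn j (i |: C).
set c := sgn j C; set d := sgn i (j |: C) => E.
have E2 : b * d = - (a * c).
  have := sgn_sq i C; have := sgn_sq i (j |: C); rewrite -/a -/d => dd aa.
  transitivity (a * (a * b) * d); first by rewrite mulrA aa mul1r.
  rewrite E; transitivity (- (a * c) * (d * d)); first by ring.
  by rewrite dd mulr1.
set f := xdiv i _.
transitivity ((b * d + a * c) * ('X_j * f)); first by ring.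
by rewrite E2 addNr mul0r.
Qed.

Lemma D_ext v w : v =1 w -> D v =1 D w.
Proof. by move=> E B; apply: eq_bigr => i _; rewrite E. Qed.

Lemma DB v w B : D (fun A => v A - w A) B = D v B - D w B.
Proof. by rewrite /D -sumrB; apply: eq_bigr => i _; rewrite !mulrBr. Qed.

Lemma DDd v w B : D (fun A => v A + w A) B = D v B + D w B.
Proof. by rewrite /D -big_split; apply: eq_bigr => i _; rewrite !mulrDr. Qed.

Lemma T0 i v : v =1 (fun=> 0) -> T i v =1 (fun=> 0).
Proof. by move=> E A; rewrite /T E xdiv0 mulr0; case: ifP. Qed.

Lemma cycle_red (s : seq 'I_n) v : D v =1 (fun=> 0) ->
  exists w u, [/\ forall B, v B = D w B + u B, D u =1 (fun=> 0),
    forall i B, i \in s -> i \in B -> u B = 0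
    & forall i B m, i \in s -> (0 < m i)%N -> (u B)@_m = 0].
Proof.
move=> Dv; elim: s => [|i s [w [u [E Du U1 U2]]]].
  exists (fun=> 0), v; split=> // B.
  by rewrite /D big1 ?add0r // => i _; rewrite !mulr0.
have Eu B : u B = D (T i u) B + P i u B.
  have := homotopy i u B; rewrite (T0 i Du) addr0 => ->.
  by rewrite subrK.
exists (fun A => w A + T i u A), (P i u); split.
- by move=> B; rewrite E DDd -addrA -Eu.
- move=> B; have := D_ext Eu B; rewrite Du DDd DD add0r => H; exact/esym/H.
- move=> k B; rewrite inE /P; case: eqP => [-> _ ->|_ /= Hk HB] //.
  case: ifP => // _; rewrite (U1 _ _ Hk HB).
  by rewrite /free_of xdiv0 mulr0 subrr.
- move=> k B m; rewrite inE /P; case: ifP => _; first by rewrite mcoeff0.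
  rewrite mcoeff_free_of; case: eqP => [-> _ ->|_ /= Hk Hm] //.
  by case: ifP => // _; exact: U2 Hk Hm.
Qed.

Lemma cycle_total v : D v =1 (fun=> 0) ->
  exists w (c : K), forall B, v B = D w B + (if B == set0 then c%:MP else 0).
Proof.
move=> /(cycle_red (enum 'I_n)) [w [u [E _ U1 U2]]].
exists w, ((u set0)@_0%MM) => B; rewrite E; congr (_ + _).
case: eqP => [->|/eqP/set0Pn[i Hi]]; last by apply: U1 Hi; rewrite mem_enum.
apply/mpolyP => m; rewrite mcoeffC; case: (altP (m =P 0%MM)) => [->|nz].
  by rewrite mulr1.
rewrite mulr0; have [i Hi] : exists i, (0 < m i)%N.
  apply/existsP; apply: contraNT nz; rewrite negb_exists => /forallP H.
  apply/eqP/mnmP => i; rewrite mnm0E; apply/eqP.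
  by have := H i; rewrite -leqNgt leqn0.
by apply: U2 Hi; rewrite mem_enum.
Qed.

(* Transport to the graded pieces of the Koszul complex. *)
Local Notation Kos := (koszul K n).
Local Notation chains p := {ffun fbasis Kos p -> S}.

Definition ext p (v : chains p) : {set 'I_n} -> S :=
  fun A => if insub A is Some b then v b else 0.

Definition res p w : chains p := [ffun b => w (val b)].

Lemma ext_val p (v : chains p) (b : fbasis Kos p) : ext v (val b) = v b.
Proof. by rewrite /ext valK. Qed.

Lemma ext_out p (v : chains p) A : #|A| != p -> ext v A = 0.
Proof. by move=> H; rewrite /ext insubF //; apply: negbTE. Qed.

Lemma diff_D p w : diff (res p.+1 w) = res p (D w).
Proof.
apply/ffunP => B; rewrite !ffunE /D.
under eq_bigr => A _.
  rewrite ffunE /= /kdiff big_distrr /=.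
  over.
rewrite (exchange_big_dep predT) //=.
have cB := eqP (valP B).
rewrite (bigID (fun i => i \notin val B)) /= [X in _ + X]big1 ?addr0; last first.
  move=> i /negbNE Hi; rewrite big1 // => A /andP[_ /eqP E].
  by move: Hi; rewrite -E !inE eqxx.
apply: eq_bigr => i Hi.
have cA : #|i |: val B| == p.+1 by rewrite cardsU1 Hi cB.
rewrite (big_pred1 (Sub (i |: val B) cA)).
  by rewrite SubK sgnU1 // ltnn mul1r mulrC -mulrA.
move=> A /=; apply/andP/eqP => [[HA /eqP E]|->].
  by apply: val_inj; rewrite SubK -E setD1K.
by rewrite SubK setU11 setU1K // eqxx.
Qed.

Lemma res_ext p (v : chains p) : res p (ext v) = v.
Proof. by apply/ffunP => b; rewrite ffunE ext_val. Qed.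

Lemma diff_ext p (v : chains p.+1) : diff v = res p (D (ext v)).
Proof. by rewrite -diff_D res_ext. Qed.

Lemma D_ext_out p (v : chains p) B : #|B|.+1 != p -> D (ext v) B = 0.
Proof.
move=> H; rewrite /D big1 // => i Hi; rewrite ext_out ?mulr0 //.
by rewrite cardsU1 Hi.
Qed.

Lemma cycle_bd p (v : chains p) : D (ext v) =1 (fun=> 0) ->
  exists (w : chains p.+1) (c : K),
    forall b, v b = diff w b + (if val b == set0 then c%:MP else 0).
Proof.
move=> /cycle_total [w [c E]]; exists (res p.+1 w), c => b.
by rewrite diff_D ffunE -E ext_val.
Qed.

Lemma const_D w : (D w set0)@_0%MM = 0.
Proof.
rewrite /D raddf_sum /= big1 // => i _.
by rewrite mulrCA mcoeffMXU mnm0E.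
Qed.

Theorem koszul_free_resolution :
  free_resolution_of_K (@koszul_aug K n).
Proof.
have c0 : #|set0 : {set 'I_n}| == 0%N by rewrite cards0.
pose b0 : fbasis Kos 0 := Sub set0 c0.
have eq_b0 (b : fbasis Kos 0) : b = b0.
  apply: val_inj; rewrite SubK; apply/eqP; rewrite -cards_eq0; exact: (valP b).
have augE (v : chains 0) : augmentation (@koszul_aug K n) v = (v b0)@_0%MM.
  rewrite /augmentation (big_pred1 b0) ?mulr1 // => b.
  by rewrite /= (eq_b0 b) eqxx.
split.
- move=> p A B; rewrite /shift_homog /= leqnSn subSnn /kdiff.
  apply: rpred_sum => i _.
  by case: (sgn_cases i (val A)) => ->;
    rewrite ?mulN1r ?mul1r ?dhomogN dhomogX /= mdeg1.
- by [].
- by move=> x; exists [ffun=> x%:MP]; rewrite augE ffunE mcoeffC eqxx mulr1.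
- move=> v; rewrite augE; split=> [v0|[w <-]]; last first.
    by rewrite diff_ext ffunE SubK const_D.
  have [w [c E]] := @cycle_bd _ v (fun B => D_ext_out v (isT : #|B|.+1 != 0%N)).
  exists w; apply/ffunP => b; rewrite E (eq_b0 b) SubK eqxx.
  move: v0; rewrite E SubK eqxx mcoeffD diff_ext ffunE SubK const_D add0r.
  by rewrite mcoeffC eqxx mulr1 => ->; rewrite mpolyC0 addr0.
- move=> p v; split=> [dv|[w <-]]; last first.
    apply/ffunP => b; rewrite [diff w]diff_ext diff_D !ffunE.
    exact: DD.
  have Dv : D (ext v) =1 (fun=> 0).
    move=> B; case: (altP (#|B| =P p)) => [/eqP cB|nB]; last first.
      by apply: D_ext_out.
    have /ffunP/(_ (Sub B cB)) := dv.
    by rewrite diff_ext !ffunE SubK.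
  have [w [c E]] := cycle_bd Dv; exists w; apply/ffunP => b.
  rewrite E; case: eqP => [b0E|]; last by rewrite addr0.
  by have := valP b; rewrite /= b0E cards0.
Qed.

End KoszulExact.
End KoszulExact.

(* Main.v *)
Require Import Defs.
From mathcomp Require Import all_boot all_order all_algebra zify.

(* Regularity is computed one multidegree at a time: in multidegree m the
   Koszul homology of a monomial ideal I is the homology of the complex of the
   sets A with x^m / x_A in I.  The component I_<d> has a linear resolution iff
   the ideal generated by the generators of I of degree at most d has
   regularity at most d.

   Sufficiency.  Adding to a monomial ideal M of regularity at most d a
   generator u of degree at most d, with M : u generated by variables, keeps
   the regularity at most d: the new faces are matched in pairs by one variable.
   Condition (A) is a special case of (B).  Under (B), the vertices are added
   one by one, those of weight at least 2 last; the generators at the new vertex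
   v are added in a perfect elimination order of the complement ending with v,
   which exists by Dirac's theorem.  Under (C), the generator of the edge ij is
   added after those of the graph without ij, to which the argument for (B)
   applies.

   Necessity.  Unless one of (A), (B), (C) holds, either two vertices of weight
   at least 2 have a common neighbour, or two adjacent vertices of weight at
   least 2 are the inner vertices of an induced path k - i - j - l with ends of
   weight 1.  In both cases the complex of some component, in the multidegree
   supported on these vertices, is disconnected in a non-linear degree. *)

Set Implicit Arguments.
Unset Strict Implicit.
Unset Printing Implicit Defensive.

(** * Perfect elimination orders of chordal graphs *)

Section Dirac.
Variables (T : finType) (h : rel T).
Hypotheses (h_sym : symmetric h) (h_irr : irreflexive h) (h_chordal : chordal h).
Implicit Types (W : {set T}) (x y z : T).

(* A chord of the cycle [x :: L] cannot involve [x], so it shortens [L]. *)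
Lemma chordal_close x L :
    path h x (rcons L x) -> uniq (x :: L) -> 1 < size L ->
    (forall z, z \in L -> z != head x L -> z != last x L -> ~~ h x z) ->
  h (head x L) (last x L).
Proof.
have [k] := ubnP (size L); elim: k L => // k IH L ltLk pL uL szL far.
have shorten (y z : T) : y \in L -> z \in L -> h y z ->
    z != next (x :: L) y -> index y L < index z L -> h (head x L) (last x L).
  move=> yL zL hyz; case/splitPr: yL pL uL szL far ltLk zL => L1 R.
  move=> pL uL szL far ltLk zL nz lt.
  have yL1 : y \notin L1.
    by move: uL; rewrite /= cat_uniq /= => /and3P[_ _ /andP[/norP[]]].
  have zL1 : z \notin L1.
    apply/negP => zL1; move: lt; rewrite !index_cat (negbTE yL1) zL1 /= eqxx.
    by rewrite addn0 ltnNge ltnW // index_mem.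
  have zR : z \in R.
    move: zL; rewrite mem_cat (negbTE zL1) inE /=; case: eqP => // zy.
    by rewrite zy h_irr in hyz.
  case/splitPr: zR pL uL szL far ltLk nz lt {zL} => L2 L3.
  case: L2 => [|b L2] pL uL szL far ltLk nz lt.
    case/negP: nz; rewrite next_nth !inE mem_cat inE eqxx !orbT.
    move: uL => /=; rewrite mem_cat inE !negb_or => /andP[/and3P[_ xy _] _].
    rewrite (negbTE xy) index_cat (negbTE yL1) /= eqxx addn0.
    by rewrite nth_cat ltnNge leqnSn /= subSn // subnn.
  (* The chord bypasses the nonempty segment [b :: L2]; the ends of the path and the condition [far]
     persist. *)
  pose L' := L1 ++ y :: z :: L3.
  have hd : head x L' = head x (L1 ++ y :: (b :: L2) ++ z :: L3).
    by rewrite /L'; case: (L1).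
  have lst : last x L' = last x (L1 ++ y :: (b :: L2) ++ z :: L3).
    by rewrite /L' !(last_cat, last_cons).
  have sub : subseq L' (L1 ++ y :: (b :: L2) ++ z :: L3).
    by rewrite cat_subseq //= eqxx; exact: (suffix_subseq (b :: L2) (z :: L3)).
  rewrite -hd -lst; apply: IH.
  - by move: ltLk; rewrite !size_cat /= size_cat /=; lia.
  - move: pL; rewrite /L' !rcons_cat !cat_path /= rcons_cat cat_path /= hyz.
    by case/and5P=> -> -> _ _ /andP[_ ->].
  - by apply: subseq_uniq uL; rewrite /= eqxx.
  - by rewrite !size_cat /=; lia.
  - by move=> t /(mem_subseq sub) tL; rewrite hd lst; apply: far.
have [sz2|sz3] := leqP (size L) 2.
  by case: L pL szL sz2 {IH ltLk uL far shorten} => [|s [|t []]] //= /and4P[].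
have [y [z [yc zc hyz nyz nzy]]] : exists y z,
    [/\ y \in x :: L, z \in x :: L, h y z, z != next (x :: L) y
       & y != next (x :: L) z].
  by apply: h_chordal => //; rewrite /ucycle /= pL.
(* By [far], the other end of a chord at [x] is the head or the last of [L], hence a cyclic
   neighbour of [x]. *)
have noX t : t \in L -> h x t -> t != next (x :: L) x ->
    x != next (x :: L) t -> False.
  move=> tL hxt tn nt; have := far t tL; rewrite hxt /=.
  case: eqP => [th|_].
    by move: tn; rewrite th; case: (L) szL => //= t0 l _; rewrite eqxx eqxx.
  case: eqP => [tl|_ /(_ isT isT) //].
  case/lastP: L tL tl nt uL {pL szL far ltLk shorten yc zc nyz nzy tn sz3} => // L1 t1.
  rewrite last_rcons => _ -> + uL; rewrite next_nth inE mem_rcons inE eqxx orbT /=.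
  move: uL => /=; rewrite mem_rcons inE rcons_uniq negb_or => /and3P[/andP[xt _] t1L _].
  rewrite (negbTE xt) -cats1 index_cat (negbTE t1L) /= eqxx addn0 nth_default ?eqxx //.
  by rewrite size_cat addn1.
have ynz : y != z by apply: contraTneq hyz => ->; rewrite h_irr.
move: yc zc; rewrite !inE.
case/predU1P => [yx|yL]; case/predU1P => [zx|zL].
- by rewrite yx zx eqxx in ynz.
- by subst y; case: (noX z).
- by subst z; case: (noX y); rewrite // h_sym.
case: (ltngtP (index y L) (index z L)) => [lt|lt|E].
- exact: (shorten y z).
- by apply: (shorten z y); rewrite // h_sym.
- by case/eqP: ynz; rewrite -(nth_index y yL) E nth_index.
Qed.

Definition simplicial W z := forall k l,
  k \in W -> l \in W -> h z k -> h z l -> k != l -> h k l.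

(* The neighbourhood [S] of a component [C] of the non-neighbours of [x] is a
   clique, so a simplicial vertex of [C :|: S] lying in [C] is simplicial in
   [W]. *)
Lemma simplicial_far W x : x \in W ->
  (exists y, [/\ y \in W, y != x & ~~ h x y]) ->
  exists z, [/\ z \in W, z != x, ~~ h x z & simplicial W z].
Proof.
have [k] := ubnP #|W|; elim: k W x => // k IH W x ltWk xW [y [yW ynx hxy]].
pose U := [set u in W | (u != x) && ~~ h x u].
pose r := [rel u v | [&& h u v, u \in U & v \in U]].
pose C := [set u | connect r y u].
have yU : y \in U by rewrite inE yW ynx.
have yC : y \in C by rewrite inE connect0.
have CU u : u \in C -> u \in U.
  rewrite inE => /connectP[p + ->]; case/lastP: p => // p t; rewrite last_rcons.
  by rewrite rcons_path => /andP[_ /and3P[]].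
have Cclosed u v : u \in C -> v \in U -> h u v -> v \in C.
  move=> uC vU huv; rewrite inE; apply: connect_trans (connect1 _).
    by move: uC; rewrite inE; apply.
  by rewrite /= huv vU CU.
pose S := [set s in W | (s \notin C) && [exists c in C, h s c]].
have SX s : s \in S -> h x s.
  rewrite inE => /and3P[sW sC /existsP[c /andP[cC hsc]]].
  apply: contraNT sC => hxs; apply: (Cclosed c); rewrite 1?h_sym // inE sW hxs.
  rewrite andbT; apply: contraTneq hsc => ->.
  by have := CU c cC; rewrite inE => /and3P[].
have r_sym : connect_sym r.
  by apply: sym_connect_sym => u v; rewrite /r /= h_sym; congr (_ && _); exact: andbC.
(* A simple path in [C] joins a neighbour of [s] to one of [t]. Closed up through [t], [x], [s], it
   is a cycle in which [x] sees only [s] and [t], so [chordal_close] applies. *)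
have Sclique s t : s \in S -> t \in S -> s != t -> h s t.
  move=> sS tS st; have hxs := SX s sS; have hxt := SX t tS.
  move: (sS) (tS); rewrite !inE => /and3P[sW sC /existsP[cs /andP[csC hs]]].
  move=> /and3P[tW tC /existsP[ct /andP[ctC ht]]].
  have : connect r cs ct.
    by move: csC ctC; rewrite !inE r_sym => /connect_trans; apply.
  case/connectP=> p0 /shortenP[p pp up _] Ect.
  have pC u : u \in cs :: p -> u \in C.
    move=> up'; rewrite inE; move: csC; rewrite inE => /connect_trans; apply.
    case/splitPl: up' pp => p1 p2 <-; rewrite cat_path => /andP[pp1 _].
    by apply/connectP; exists p1.
  have nX u : u \in cs :: p -> (u != x) && ~~ h x u.
    by move/pC/CU; rewrite inE => /and3P[_ -> ->].
  pose L := s :: rcons (cs :: p) t.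
  have -> : s = head x L by [].
  have -> : t = last x L by rewrite /= last_rcons.
  have notin u : u \notin C -> u \notin cs :: p by apply: contra => /pC.
  have sC' : s \notin C by rewrite inE.
  have tC' : t \notin C by rewrite inE.
  have neqx u : h x u -> x != u by apply: contraTneq => <-; rewrite h_irr.
  apply: chordal_close; rewrite /L.
  - rewrite /= !rcons_path /= last_rcons hxs hs -Ect h_sym ht h_sym hxt !andbT.
    by apply: sub_path pp => u v /and3P[].
  - have xN : x \notin cs :: p by apply/negP => /nX; rewrite eqxx.
    rewrite cons_uniq cons_uniq (in_cons s) !mem_rcons !(in_cons t) rcons_uniq up.
    rewrite (negbTE xN) (negbTE (notin s sC')) (notin t tC') (negbTE st).
    by rewrite (negbTE (neqx s hxs)) (negbTE (neqx t hxt)).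
  - by [].
  - move=> z; rewrite inE mem_rcons inE => /or3P[/eqP->|/eqP->|zp]; rewrite /= ?eqxx //.
      by rewrite last_rcons eqxx.
    by have /andP[] := nX z zp.
pose W' := C :|: S.
have W'W : W' \subset W.
  apply/subsetP => u; rewrite inE => /orP[/CU|]; rewrite inE => /andP[] //.
have simpW z : z \in C -> simplicial W' z ->
    exists z, [/\ z \in W, z != x, ~~ h x z & simplicial W z].
  move=> zC zs; exists z; have := CU z zC; rewrite inE => /and3P[-> -> ->].
  have N u : u \in W -> h z u -> u \in W'.
    move=> uW hzu; rewrite in_setU; case: (boolP (u \in C)) => //= uC.
    by rewrite in_set uW uC; apply/existsP; exists z; rewrite zC h_sym.
  by split=> // k' l kW lW hk hl; apply: zs; rewrite ?N.
have cW' : #|W'| < k.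
  apply: leq_trans (_ : #|W| <= k); last by [].
  apply: proper_card; rewrite properE W'W; apply/subsetPn; exists x => //.
  rewrite inE negb_or; apply/andP; split; apply/negP.
    by move/CU; rewrite inE eqxx andbF.
  by move/SX; rewrite h_irr.
have inC s z : s \in S -> z \in W' -> z != s -> ~~ h s z -> z \in C.
  move=> sS; rewrite inE => /orP[//|zS] zs; rewrite Sclique // eq_sym //.
have far_in W0 s : s \in W0 -> (exists u, [&& u \in W0, u != s & ~~ h s u]) ->
    #|W0| < k -> exists z, [/\ z \in W0, z != s, ~~ h s z & simplicial W0 z].
  by move=> sW [u /and3P[uW us hsu]] c; apply: IH => //; exists u.
(* Induction from [s] yields a vertex not adjacent to [s]; it lies outside the clique [S], hence in
   [C]. *)
have [/existsP[s /andP[sS /existsP nb]]|Sfull] :=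
    boolP [exists s in S, [exists u, [&& u \in W', u != s & ~~ h s u]]].
  have sW' : s \in W' by rewrite inE sS orbT.
  have [z [zW zs hsz zsim]] := far_in _ s sW' nb cW'.
  exact: simpW (inC s z sS zW zs hsz) zsim.
(* The vertex found from [c] cannot be in [S]: it would have the non-neighbour [c], against
   [Sfull]. *)
have [/existsP[c /andP[cC /existsP nb]]|Cfull] :=
    boolP [exists c in C, [exists u, [&& u \in W', u != c & ~~ h c u]]].
  have cW : c \in W' by rewrite inE cC.
  have [z [zW zc hcz zsim]] := far_in _ c cW nb cW'.
  apply: (simpW z) => //; move: (zW); rewrite inE => /orP[//|zS].
  case/negP: Sfull; apply/existsP; exists z; rewrite zS; apply/existsP; exists c.
  by rewrite cW eq_sym zc h_sym.
(* Now [C :|: S] is a clique, so [y] itself is simplicial in it. *)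
apply: (simpW y) => // k' l kW lW _ _ nkl.
apply: contraT => nh; move: (kW); rewrite inE => /orP[kC|kS].
  case/negP: Cfull; apply/existsP; exists k'; rewrite kC; apply/existsP; exists l.
  by rewrite lW eq_sym nkl.
case/negP: Sfull; apply/existsP; exists k'; rewrite kS; apply/existsP; exists l.
by rewrite lW eq_sym nkl.
Qed.

(** If [x] is adjacent to all the rest of [W], a simplicial vertex of [W :\ x] stays simplicial in
    [W]; otherwise [simplicial_far] applies. *)
Lemma simplicial_neq W x : x \in W -> 1 < #|W| ->
  exists z, [/\ z \in W, z != x & simplicial W z].
Proof.
have [k] := ubnP #|W|; elim: k W x => // k IH W x ltWk xW W1.
have [/existsP[y /and3P[yW yx hxy]]|full] :=
    boolP [exists y, [&& y \in W, y != x & ~~ h x y]].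
  have [|z [zW zx _ zsim]] := simplicial_far xW; first by exists y.
  by exists z.
have univ y : y \in W -> y != x -> h x y.
  move=> yW yx; apply: contraT => nh; case/negP: full.
  by apply/existsP; exists y; rewrite yW yx.
have cWx := cardsD1 x W; rewrite xW add1n in cWx.
have [y yWx] : exists y, y \in W :\ x by apply/card_gt0P; rewrite cWx in W1.
have [z [zWx zsim]] : exists z, z \in W :\ x /\ simplicial (W :\ x) z.
  have [c1|c1] := leqP #|W :\ x| 1.
    exists y; split=> // k' l kW lW _ _ nkl.
    by have /card_le1_eqP/(_ k' l kW lW) kl := c1; rewrite kl eqxx in nkl.
  have [|z [zW _ zs]] := IH (W :\ x) y _ yWx c1; last by exists z.
  by rewrite -ltnS -cWx.
have /setD1P[zx zW] := zWx; exists z; split=> // k' l kW lW hk hl nkl.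
have [kx|kx] := eqVneq k' x; first by rewrite kx univ // -kx eq_sym.
have [lx|lx] := eqVneq l x; first by rewrite lx h_sym univ // -lx.
by apply: zsim; rewrite // !inE ?kx ?lx.
Qed.

(** A perfect elimination order, vertices of smaller [rk] being eliminated first. *)
Definition elimination_rank W (rk : T -> nat) := forall j k l,
  j \in W -> k \in W -> l \in W -> rk j < rk k -> rk j < rk l -> k != l ->
  h j k -> h j l -> h k l.

(** A simplicial vertex other than [x] gets rank 0 and the other ranks are shifted up; sparing [x]
    each time leaves it last. *)
Lemma elimination_rank_last x : exists rk : T -> nat,
  [/\ injective rk, forall k, k != x -> rk k < rk x & elimination_rank setT rk].
Proof.
suff rank_on W : x \in W -> exists rk : T -> nat,
    [/\ {in W &, injective rk}, {in W, forall k, k != x -> rk k < rk x}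
      & elimination_rank W rk].
  have [|rk [inj lst el]] := rank_on setT; first by rewrite inE.
  exists rk; split=> // [k l E|k kx]; first by apply: inj; rewrite ?inE.
  by apply: lst; rewrite ?inE.
have [k] := ubnP #|W|; elim: k W => // k IH W ltWk xW.
have [W1|W1] := leqP #|W| 1.
  have eqx := card_le1_eqP W1.
  exists (fun=> 0); split=> [u v uW vW _|u uW|j u l _ _ _] //; first exact: eqx.
  by rewrite (eqx u x) ?eqxx.
have [z [zW zx zs]] := simplicial_neq xW W1.
have cWz := cardsD1 z W; rewrite zW add1n in cWz.
have [|| rk [inj lst el]] := IH (W :\ z); first by rewrite -ltnS -cWz.
  by rewrite !inE eq_sym zx.
have mz u : u \in W -> u != z -> u \in W :\ z by rewrite !inE => -> ->.
exists (fun u => if u == z then 0 else (rk u).+1); split.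
- move=> u v uW vW; case: eqP => [->|/eqP uz]; case: eqP => [->|/eqP vz] // [].
  by apply: inj; apply: mz.
- move=> u uW ux; rewrite [x == z]eq_sym (negbTE zx); case: eqP => // /eqP uz.
  by rewrite ltnS lst ?mz.
move=> j u l jW uW lW; have [->|uz] := eqVneq u z; first by rewrite ltn0.
have [->|lz] := eqVneq l z; first by rewrite ltn0.
have [-> _ _ nul hzu hzl|jz] := eqVneq j z; first exact: zs.
by rewrite !ltnS; apply: el; apply: mz.
Qed.

End Dirac.

(** * Multigraded Koszul homology and regularity *)

Section ScalarKoszul.
Import GRing.Theory.
Local Open Scope ring_scope.
Variables (K : fieldType) (n : nat).
Notation S := {mpoly K[n]}.
Implicit Types (c z : {set 'I_n} -> K) (A B : {set 'I_n}) (D E : pred {set 'I_n}).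

Definition scalar_sign (i : 'I_n) A : K := (-1) ^+ #|[set j in A | (j < i)%N]|.

Lemma ksignE i A : ksign K i A = (scalar_sign i A)%:MP.
Proof. by rewrite /ksign rmorphXn rmorphN1. Qed.

Lemma scalar_sign0 i : scalar_sign i set0 = 1.
Proof.
rewrite /scalar_sign (_ : [set _ in _ | _] = set0) ?cards0 //.
by apply/setP => j; rewrite !inE.
Qed.

(** The reduced simplicial boundary, empty face included; it is [KoszulExact.D] at the point (1,
    ..., 1). *)
Definition bd c : {set 'I_n} -> K :=
  fun B => \sum_(i | i \notin B) scalar_sign i B * c (i |: B).

Definition cone s c : {set 'I_n} -> K :=
  fun A => if s \in A then scalar_sign s (A :\ s) * c (A :\ s) else 0.

Local Notation ev f := (meval (fun=> 1) f).

Lemma bd_meval (v : {set 'I_n} -> S) B :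
  ev (KoszulExact.D v B) = bd (fun A => ev (v A)) B.
Proof.
rewrite /KoszulExact.D raddf_sum; apply: eq_bigr => i _ /=.
by rewrite ksignE mul_mpolyC mevalZ mevalM mevalXU mul1r.
Qed.

Lemma eq_bd c z : c =1 z -> bd c =1 bd z.
Proof. by move=> E B; apply: eq_bigr => i _; rewrite E. Qed.

Lemma bdB c z B : bd (fun A => c A - z A) B = bd c B - bd z B.
Proof. by rewrite /bd -sumrB; apply: eq_bigr => i _; rewrite mulrBr. Qed.

Lemma bdD c z B : bd (fun A => c A + z A) B = bd c B + bd z B.
Proof. by rewrite /bd -big_split; apply: eq_bigr => i _; rewrite mulrDr. Qed.

Lemma bd_bd c B : bd (bd c) B = 0.
Proof.
pose v A : S := (c A)%:MP.
have E A : ev (KoszulExact.D v A) = bd c A.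
  by rewrite bd_meval; apply: eq_bd => A'; rewrite mevalC.
by rewrite -(eq_bd E) -bd_meval KoszulExact.DD meval0.
Qed.

(* Evaluation of [KoszulExact.homotopy] at (1, ..., 1), for polynomial chains
   whose coefficients off [s] are divisible by x_s. *)
Lemma cone_bd s c B : bd (cone s c) B + cone s (bd c) B = c B.
Proof.
pose v A : S := if s \in A then (c A)%:MP else 'X_s * (c A)%:MP.
have evv A : ev (v A) = c A.
  by rewrite /v; case: ifP => _; rewrite ?mevalM ?mevalXU ?mul1r mevalC.
have evT A : ev (KoszulExact.T s v A) = cone s c A.
  rewrite /KoszulExact.T /cone; case: ifP => // _; last exact: meval0.
  by rewrite ksignE mul_mpolyC mevalZ /v setD11 KoszulExact.xdivX mevalC.
have evP : ev (KoszulExact.P s v B) = 0.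
  rewrite /KoszulExact.P; case: ifP => sB; first exact: meval0.
  by rewrite /v sB /KoszulExact.free_of KoszulExact.xdivX subrr meval0.
have := congr1 (fun f => ev f) (KoszulExact.homotopy s v B).
rewrite /= mevalD mevalB evv evP subr0 bd_meval (eq_bd evT) => <-.
congr (_ + _); rewrite /KoszulExact.T /cone; case: ifP => sB; last by rewrite meval0.
rewrite ksignE mul_mpolyC mevalZ; congr (_ * _).
rewrite /KoszulExact.D KoszulExact.xdiv_sum raddf_sum /=; apply: eq_bigr => i iB.
rewrite KoszulExact.xdiv_sgn ksignE mul_mpolyC mevalZ; congr (_ * _).
rewrite /v !inE eqxx; have [->|nsi] := eqVneq s i.
  by rewrite /= KoszulExact.xdivX mevalC.
by rewrite /= mulrCA KoszulExact.xdivX mevalM mevalXU mul1r mevalC.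
Qed.

Definition supported D p c := forall A, c A != 0 -> D A /\ #|A| = p.

(** For a simplicial complex [D], this is vanishing of reduced homology in dimension p - 1: faces
    are graded by cardinality. *)
Definition acyclic D p := forall c, supported D p c -> bd c =1 (fun=> 0) ->
  exists2 z, supported D p.+1 z & bd z =1 c.

Definition down_closed D := forall A B, B \subset A -> D A -> D B.

Lemma acyclic_mono D E p : (forall A, #|A| = p.+1 -> D A -> E A) ->
  (forall A, #|A| = p -> E A -> D A) -> acyclic D p -> acyclic E p.
Proof.
move=> DE ED acD c cE c0; have [|z zD zc] := acD c _ c0.
  by move=> A /cE[EA pA]; split=> //; apply: ED.
by exists z => // A /zD[DA pA]; split=> //; apply: DE.
Qed.

Lemma acyclic_empty D p : (forall A, #|A| = p -> ~~ D A) -> acyclic D p.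
Proof.
move=> nD c cD _; have c0 A : c A = 0.
  by case: (eqVneq (c A) 0) => // /cD[DA /nD]; rewrite DA.
exists (fun=> 0) => [A|B]; first by rewrite eqxx.
by rewrite c0 /bd big1 // => i _; rewrite mulr0.
Qed.

Lemma supported_bd D p c A : down_closed D -> supported D p c ->
  bd c A != 0 -> D A /\ #|A|.+1 = p.
Proof.
move=> dcD cD; have [/existsP[i /andP[iA ci]] _|nex] :=
  boolP [exists i, (i \notin A) && (c (i |: A) != 0)].
  have [DA pA] := cD _ ci; split; first by apply: dcD DA; apply: subsetUr.
  by rewrite -pA cardsU1 iA.
rewrite /bd big1 ?eqxx // => i iA; case: (eqVneq (c (i |: A)) 0) => [->|ci].
  by rewrite mulr0.
by case/negP: nex; apply/existsP; exists i; rewrite iA.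
Qed.

(* The cone from [s] over the part of a cycle outside [D] moves it into [D]. *)
Lemma acyclic_collapse D E s p : down_closed D -> down_closed E ->
  (forall A, D A -> E A) ->
  (forall A, E A -> ~~ D A -> E (s |: A) && ~~ D (s |: A)) ->
  (forall A, E A -> ~~ D A -> E (A :\ s) && ~~ D (A :\ s)) ->
  acyclic D p -> acyclic E p.
Proof.
move=> dcD dcE DE addE remE acD c cE c0.
pose cN A := if D A then 0 else c A.
pose z := cone s cN.
have zE : supported E p.+1 z.
  move=> A; rewrite /z /cone /cN; case: ifP => [sA|_]; last by rewrite eqxx.
  case: ifP => [_|/negbT nD]; first by rewrite mulr0 eqxx.
  have [->|/cE[EA cA] _] := eqVneq (c (A :\ s)) 0; first by rewrite mulr0 eqxx.
  have /andP[] := addE _ EA nD; rewrite setD1K // => -> _; split=> //.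
  by rewrite (cardsD1 s A) sA cA.
pose cD A := if D A then c A else 0.
have cDD : supported D p cD.
  by move=> A; rewrite /cD; case: ifP => [DA /cE[]|_]; rewrite ?eqxx.
(* As [c] is a cycle, the boundary of its part outside [D] is supported in [D]. *)
have bd_cN A : bd cN A = - bd cD A.
  rewrite -[LHS]subr0 -(c0 A) -opprB -bdB; congr (- _); apply: eq_bd => B.
  by rewrite /cN /cD; case: ifP; rewrite ?subr0 ?subrr.
pose c' A := c A - bd z A.
have c'D : supported D p c'.
  move=> A c'A; have [EA cA] : E A /\ #|A| = p.
    have [cA|/cE //] := eqVneq (c A) 0; move: c'A.
    by rewrite /c' cA sub0r oppr_eq0 => /(supported_bd dcE zE)[? []].
  split=> //; apply: contraT => nD; move: c'A; rewrite /c'.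
  (* By [cone_bd], off [D] the chain [c'] equals the cone over [bd cN]; a nonzero value would put
     [A :\ s] in [D], against [remE]. *)
  have <- : cN A = c A by rewrite /cN (negbTE nD).
  rewrite -(cone_bd s cN A).
  rewrite /z addrAC subrr add0r /cone; case: ifP; last by rewrite eqxx.
  rewrite bd_cN mulf_eq0 oppr_eq0 negb_or => sA /andP[_ /(supported_bd dcD cDD)[DAs _]].
  by have /andP[_] := remE _ EA nD; rewrite DAs.
have [|w wD wc] := acD c' c'D.
  by move=> A; rewrite /c' bdB bd_bd c0 subrr.
exists (fun A => w A + z A); last by move=> A; rewrite bdD wc subrK.
move=> A; have [->|/zE //] := eqVneq (z A) 0.
by rewrite addr0 => /wD[/DE].
Qed.

(* Faces of the upper Koszul complex of [M] in multidegree [m]. *)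
Definition face (M : pred 'X_{1..n}) (m : 'X_{1..n}) : pred {set 'I_n} :=
  fun A => (mesym1 A <= m)%MM && M (m - mesym1 A)%MM.

Definition up_closed (M : pred 'X_{1..n}) := forall x y, (x <= y)%MM -> M x -> M y.

(* Castelnuovo-Mumford regularity of a monomial ideal, in multigraded form. *)
Definition reg_le (M : pred 'X_{1..n}) d := forall m p,
  (p + d < mdeg m)%N -> acyclic (face M m) p.

Lemma mesym1_le A B : B \subset A -> (mesym1 B <= mesym1 A)%MM.
Proof.
move=> BA; apply/mnm_lepP => i; rewrite !mnmE.
by case: (boolP (i \in B)) => // /(subsetP BA) ->.
Qed.

Lemma lemB2 (x y m : 'X_{1..n}) : (x <= y)%MM -> (m - y <= m - x)%MM.
Proof. by move=> /mnm_lepP le; apply/mnm_lepP => i; rewrite !mnmBE leq_sub2l. Qed.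

Lemma face_down M m : up_closed M -> down_closed (face M m).
Proof.
move=> uM A B BA /andP[le MA]; rewrite /face (lepm_trans (mesym1_le BA) le).
by apply: uM MA; apply/lemB2/mesym1_le.
Qed.

(* In multidegree [m] the new faces are the [A] whose complement in [m - u]
   avoids the variables of the colon ideal, so they are matched by any other
   variable of [m - u]. *)
Lemma reg_add_gen (M : pred 'X_{1..n}) u d : up_closed M -> reg_le M d ->
    (mdeg u <= d)%N ->
    (forall x, M (u + x)%MM -> exists2 t, (0 < x t)%N & M (u + U_(t))%MM) ->
  reg_le (fun x => M x || (u <= x)%MM) d.
Proof.
move=> uM regM du colon m p lt.
set M' := fun x => _.
have uM' : up_closed M'.
  by move=> x y xy /orP[/(uM _ _ xy)|/lepm_trans/(_ xy)] H; rewrite /M' H ?orbT.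
have sub A : face M m A -> face M' m A by rewrite /face /M' => /andP[-> ->].
have newP A : face M' m A -> ~~ face M m A ->
    [/\ (mesym1 A <= m)%MM, (u <= m - mesym1 A)%MM & ~~ M (m - mesym1 A)%MM].
  by rewrite /face => /andP[-> /orP[->|->]] // ->.
(* The colon ideal is generated by variables, so membership in [M] means that one of them still has
   room in [m] beyond [u] and [A]. *)
have colonA A : (mesym1 A <= m)%MM -> (u <= m - mesym1 A)%MM ->
    M (m - mesym1 A)%MM = [exists t, (u t + (t \in A) < m t)%N && M (u + U_(t))%MM].
  move=> Am uA; apply/idP/existsP => [MA|[t /andP[lt_t Mt]]].
    have [|t t0 Mt] := colon (m - mesym1 A - u)%MM; first by rewrite addmC submK.
    exists t; rewrite Mt andbT; move: t0; rewrite !mnmBE mnmE; lia.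
  apply: uM Mt; apply/mnm_lepP => i; rewrite mnmDE mnm1E mnmBE mnmE.
  move/mnm_lepP/(_ i): uA; rewrite mnmBE mnmE.
  by case: eqP => [<-|_]; lia.
(* If [x_s] is outside the colon ideal and has room in [m] beyond [u], toggling [s] pairs the new
   faces. *)
have [/existsP[s /andP[us nMs]]|none] :=
    boolP [exists s, (u s < m s)%N && ~~ M (u + U_(s))%MM].
  have new_toggle A A' : (forall t, t != s -> (t \in A') = (t \in A)) ->
      face M' m A -> ~~ face M m A -> face M' m A' && ~~ face M m A'.
    move=> AA' fA nfA; have [Am uA] := newP A fA nfA; rewrite colonA // => nex.
    have uA' : (u <= m - mesym1 A')%MM.
      apply/mnm_lepP => i; move/mnm_lepP/(_ i): uA; rewrite !mnmBE !mnmE.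
      by have [->|is_] := eqVneq i s; [lia|rewrite AA'].
    have Am' : (mesym1 A' <= m)%MM.
      apply/mnm_lepP => i; move/mnm_lepP/(_ i): Am; rewrite !mnmE.
      by have [->|is_] := eqVneq i s; [lia|rewrite AA'].
    rewrite /face /M' Am' uA' orbT colonA //=; apply: contra nex.
    move=> /existsP[t /andP[lt_t Mt]]; apply/existsP; exists t; rewrite Mt andbT.
    by rewrite -AA' //; apply: contraNneq nMs => <-.
  apply: (acyclic_collapse (s := s) (D := face M m)); rewrite //; try exact: face_down.
  - by move=> A; apply: new_toggle => t ts; rewrite !inE (negbTE ts).
  - by move=> A; apply: new_toggle => t ts; rewrite !inE ts.
  - exact: regM.
(* With no such [s], a new face [A] makes x^m divide x^u x_A. Then deg m is at most d + p, so there
   is no new face with [p] elements. *)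
apply: (acyclic_mono (D := face M m)) => [A _ /sub //|A pA fA|]; last exact: regM.
apply: contraT => nfA; have [Am uA] := newP A fA nfA.
rewrite colonA // => nex; suff : (mdeg m <= mdeg (u + mesym1 A)%MM)%N.
  by rewrite mdegD mdeg_mesym1 pA; lia.
rewrite !mdegE; apply: leq_sum => i _; rewrite mnmDE mnmE leqNgt.
apply: contra nex => lt_i; apply/existsP; exists i; rewrite lt_i /=.
apply: contraT => nM; case/negP: none; apply/existsP; exists i.
by rewrite nM andbT (leq_ltn_trans (leq_addr _ _) lt_i).
Qed.

Lemma reg_empty d : reg_le (fun=> false) d.
Proof.
by move=> m p _; apply: acyclic_empty => A _; rewrite /face andbF.
Qed.

Lemma eq_reg (M N : pred 'X_{1..n}) d : M =1 N -> reg_le M d -> reg_le N d.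
Proof.
move=> MN regM m p lt; apply: (acyclic_mono (D := face M m)); last exact: regM.
  by move=> A _; rewrite /face MN.
by move=> A _; rewrite /face MN.
Qed.

(* The difference of two vertices in distinct components of [D] is a cycle but
   not a boundary. *)
Lemma disconnected_not_acyclic D (C : {set 'I_n}) s0 t0 :
  D [set s0] -> D [set t0] -> s0 \in C -> t0 \notin C ->
  (forall s t, s \in C -> t \notin C -> ~~ D [set s; t]) -> ~ acyclic D 1.
Proof.
move=> Ds Dt sC tC sep ac; have st : t0 != s0 by apply: contraNneq tC => ->.
pose c A : K := if A == [set s0] then 1 else if A == [set t0] then -1 else 0.
have c1 i : c [set i] = if i == s0 then 1 else if i == t0 then -1 else 0.
  by rewrite /c !(inj_eq set1_inj).
have bd0 (w : {set 'I_n} -> K) : bd w set0 = \sum_i w [set i].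
  rewrite /bd; apply: eq_big => [i|i _]; first by rewrite inE.
  by rewrite scalar_sign0 mul1r setU0.
have [||z zD zc] := ac c.
- move=> A; rewrite /c; have [->|_] := eqVneq A [set s0]; first by rewrite cards1.
  by have [->|_] := eqVneq A [set t0]; rewrite ?eqxx // cards1.
- move=> B; have [->|nB] := eqVneq B set0.
    rewrite bd0 (bigD1 s0) // (bigD1 t0) //= !c1 !eqxx (negbTE st) big1 ?addr0 ?subrr //.
    by move=> i /andP[/negbTE is0 /negbTE it0]; rewrite c1 is0 it0.
  rewrite /bd big1 // => i iB; rewrite /c.
  have card_neq t : (i |: B == [set t]) = false.
    apply: contraNF nB => /eqP E; have := cardsU1 i B.
    by rewrite E cards1 iB => -[/esym/eqP]; rewrite cards_eq0.
  by rewrite !card_neq mulr0.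
(* No edge of [D] leaves [C], so the part of the filling inside [C] bounds the restriction of [c] to
   [C]. That has coefficient sum 1, whereas [bd_bd] at the empty face gives 0. *)
pose zC A := if A \subset C then z A else 0.
have bdC i : bd zC [set i] = if i \in C then c [set i] else 0.
  rewrite -zc /bd; case: ifP => [iC|/negbT iC].
    apply: eq_bigr => j _; rewrite /zC; case: ifPn => // nsub.
    have [->|/zD[]] := eqVneq (z (j |: [set i])) 0 => //.
    have jC : j \notin C.
      apply: contra nsub => jC; apply/subsetP => t; rewrite !inE.
      by case/orP=> /eqP->.
    by rewrite setUC (negbTE (sep i j iC jC)).
  rewrite big1 // => j _; rewrite /zC; case: ifP => [/subsetP/(_ i)|_]; last by rewrite mulr0.
  by rewrite !inE eqxx orbT (negbTE iC) => /(_ isT).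
have := bd_bd zC set0; rewrite bd0 (eq_bigr _ (fun i _ => bdC i)).
rewrite (bigD1 s0) //= sC c1 eqxx big1 ?addr0; first by apply/eqP/oner_neq0.
move=> i is0; case: ifP => // iC; rewrite c1 (negbTE is0).
by case: eqP => // it; rewrite -it iC in tC.
Qed.

End ScalarKoszul.

(** * Passage between polynomial chains and their multigraded parts *)

Section KoszulMultigraded.
Import GRing.Theory.
Local Open Scope ring_scope.
Variables (K : fieldType) (n : nat).
Notation S := {mpoly K[n]}.
Notation chains p := {ffun fbasis (koszul K n) p -> S}.
Implicit Types (A B : {set 'I_n}) (m x : 'X_{1..n}).

(** The basis element e_A has multidegree [mesym1 A], so its coefficient in multidegree [m] sits at
    [m - mesym1 A]; subtraction is truncated, hence the test. *)
Definition multipart (v : {set 'I_n} -> S) m : {set 'I_n} -> K :=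
  fun A => if (mesym1 A <= m)%MM then (v A)@_(m - mesym1 A) else 0.

Lemma multipartD (v : {set 'I_n} -> S) x A :
  multipart v (x + mesym1 A)%MM A = (v A)@_x.
Proof. by rewrite /multipart lem_addl addmK. Qed.

Lemma mesym1U1 i A : i \notin A -> mesym1 (i |: A) = (U_(i) + mesym1 A)%MM.
Proof.
move=> iA; apply/mnmP => j; rewrite mnmDE mnm1E !mnmE !inE eq_sym.
by case: eqP => //= <-; rewrite (negbTE iA).
Qed.

(** The Koszul differential preserves multidegree: the factor x_i makes up for the index [i] lost by
    the face. *)
Lemma bd_multipart v m B : bd (multipart v m) B = multipart (KoszulExact.D v) m B.
Proof.
rewrite {2}/multipart; case: ifPn => [Bm|nBm].
  rewrite /KoszulExact.D raddf_sum; apply: eq_bigr => i iB /=.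
  rewrite ksignE mcoeffCM KoszulExact.mcoeffMXU; congr (_ * _).
  rewrite /multipart mesym1U1 //.
  have -> : ((U_(i) + mesym1 B <= m)%MM = (0 < (m - mesym1 B)%MM i)%N).
    apply/mnm_lepP/idP => [/(_ i)|lt j]; first by rewrite mnmDE mnm1E eqxx mnmBE; lia.
    move/mnm_lepP/(_ j): Bm; move: lt; rewrite mnmDE mnm1E mnmBE.
    by case: eqP => [<-|_]; lia.
  case: ifP => // _; congr (_ @_ _).
  by apply/mnmP => j; rewrite !mnmBE mnmDE; lia.
rewrite /bd big1 // => i iB; rewrite /multipart mesym1U1 //.
rewrite (_ : (_ <= m)%MM = false) ?mulr0 //; apply: contraNF nBm.
by apply: lepm_trans; apply: lem_addl.
Qed.

Lemma shift_homogP s q (f : S) :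
  shift_homog s q f <-> forall x, f@_x != 0 -> (mdeg x + s = q)%N.
Proof.
rewrite /shift_homog; case: leqP => le; split.
- by move/dhomogP => H x; rewrite -mcoeff_msupp => /H /= ->; rewrite subnK.
- by move=> H; apply/dhomogP => x; rewrite mcoeff_msupp => /H /= <-; rewrite addnK.
- by move/eqP => -> x; rewrite mcoeff0 eqxx.
move=> H; apply/eqP/mpolyP => x; rewrite mcoeff0.
by have [//|/H E] := eqVneq (f@_x) 0; move: le; rewrite -E; lia.
Qed.

Lemma ext_Sub p (v : chains p) A (cA : #|A| == p) :
  KoszulExact.ext v A = v (Sub A cA).
Proof. by rewrite -KoszulExact.ext_val SubK. Qed.

Variables (M : pred 'X_{1..n}) (L : S -> Prop).
Hypothesis L_monomial : forall f : S, L f <-> forall x, f@_x != 0 -> M x.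

Lemma tensor_chainP p q (v : chains p) : tensor_chain L q v <->
  forall A x, (KoszulExact.ext v A)@_x != 0 -> M x /\ (mdeg x + p = q)%N.
Proof.
split=> [H A x|H b].
  have [/eqP cA|nA] := eqVneq #|A| p; last first.
    by rewrite KoszulExact.ext_out ?mcoeff0 ?eqxx.
  have [/L_monomial HL /shift_homogP Hd] := H (Sub A cA).
  rewrite (ext_Sub _ cA) => nz.
  by split; [apply: HL|apply: Hd].
split; first by apply/L_monomial => x; rewrite -KoszulExact.ext_val => /H[].
by apply/shift_homogP => x; rewrite -KoszulExact.ext_val => /H[].
Qed.

Lemma tensor_cycleP p q (v : chains p) : tensor_cycle L q v <->
  tensor_chain L q v /\ KoszulExact.D (KoszulExact.ext v) =1 (fun=> 0).
Proof.
case: p v => [|p] v; first by split=> [|[]//]; split=> // B; apply: KoszulExact.D_ext_out.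
have dE : diff v = 0 <-> KoszulExact.D (KoszulExact.ext v) =1 (fun=> 0).
  rewrite KoszulExact.diff_ext; split=> [E B|E]; last first.
    by apply/ffunP => b; rewrite !ffunE E.
  have [/eqP cB|nB] := eqVneq #|B| p; last by apply: KoszulExact.D_ext_out.
  by have /ffunP/(_ (Sub B cB)) := E; rewrite !ffunE.
by rewrite /= dE.
Qed.

Lemma supported_multipart p q (v : chains p) m : tensor_chain L q v ->
  supported (face M m) p (multipart (KoszulExact.ext v) m).
Proof.
move=> /tensor_chainP H A; rewrite /multipart; case: ifP => [Am nz|]; last by rewrite eqxx.
have [Mx _] := H _ _ nz; rewrite /face Am Mx; split=> //; apply/eqP.
by apply: contraTT nz => nA; rewrite KoszulExact.ext_out // mcoeff0 eqxx.
Qed.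

(** There are finitely many multidegrees of total degree [q]; the cycle is filled in each one
    separately and [W] assembles the fillings. *)
Lemma betti_of_acyclic p q :
  (forall m, mdeg m = q -> acyclic K (face M m) p) -> graded_betti L p q 0.
Proof.
move=> ac; exists (fun=> 0); split=> [[? ?]//|c _ [? ?]//|v /tensor_cycleP[Lv Dv]].
exists (fun=> 0); rewrite big_ord0 subr0.
(* The fillings are chosen over a finite type of multidegrees and extended by 0. *)
have [zf zfP] : exists zf : 'X_{1..n} -> {set 'I_n} -> K, forall m, mdeg m = q ->
    supported (face M m) p.+1 (zf m) /\
    bd (zf m) =1 multipart (KoszulExact.ext v) m.
  have /fin_all_exists[z zP] (m : 'X_{1..n < q.+1}) : exists z, mdeg m = q ->
      supported (face M m) p.+1 z /\ bd z =1 multipart (KoszulExact.ext v) m.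
    have [E|/eqP nE] := eqVneq (mdeg m) q; last by exists (fun=> 0).
    have [||z z1 z2] := ac m E (multipart (KoszulExact.ext v) m).
    - exact: supported_multipart Lv.
    - by move=> B; rewrite bd_multipart /multipart Dv mcoeff0 if_same.
    by exists z.
  exists (fun m => if insub m is Some m' then z m' else (fun=> 0)) => m E.
  have lt : (mdeg m < q.+1)%N by rewrite E.
  by rewrite (insubT (fun m => mdeg m < q.+1)%N lt); apply: zP.
pose W A : S := \sum_(m : 'X_{1..n < q.+1} | (mdeg m == q) && (mesym1 A <= m)%MM)
  zf m A *: 'X_[m - mesym1 A].
have WE A x : (W A)@_x =
    if (mdeg x + #|A| == q)%N then zf (x + mesym1 A)%MM A else 0.
  rewrite /W raddf_sum /=; have degE : mdeg (x + mesym1 A) = (mdeg x + #|A|)%N.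
    by rewrite mdegD mdeg_mesym1.
  have key (m : 'X_{1..n < q.+1}) : (mesym1 A <= m)%MM ->
      ((m - mesym1 A)%MM == x) = (bmnm m == (x + mesym1 A)%MM).
    by move=> le; apply/eqP/eqP => [<-|->]; rewrite ?addmK // submK.
  case: eqP => [E|nE]; last first.
    rewrite big1 // => m /andP[/eqP Em le]; rewrite mcoeffZ mcoeffX key //.
    by case: eqP => [mE|]; rewrite ?mulr0 //; case: nE; rewrite -degE -mE.
  have lt : (mdeg (x + mesym1 A)%MM < q.+1)%N by rewrite degE E.
  rewrite (bigD1 (BMultinom lt)) /= ?degE ?E ?eqxx ?lem_addl // big1 ?addr0.
    by rewrite mcoeffZ mcoeffX addmK eqxx mulr1.
  move=> m /andP[/andP[_ le] ne]; rewrite mcoeffZ mcoeffX key //.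
  by rewrite (negbTE (_ : bmnm m != _)) ?mulr0 //; apply: contraNneq ne => mE; apply/eqP/val_inj.
exists (KoszulExact.res p.+1 W); split.
  move=> b; rewrite ffunE; have /eqP cb := valP b.
  split; [apply/L_monomial|apply/shift_homogP] => x; rewrite WE cb;
    case: ifP => [/eqP E|_]; rewrite ?eqxx // => nz.
  have [|zs _] := zfP (x + mesym1 (val b))%MM; first by rewrite mdegD mdeg_mesym1 cb.
  by have [/andP[_]] := zs _ nz; rewrite addmK.
rewrite KoszulExact.diff_D -[v in RHS]KoszulExact.res_ext; apply/ffunP => b.
rewrite [in LHS]ffunE [in RHS]ffunE; apply/mpolyP => x; have /eqP cb := valP b.
rewrite -!multipartD -bd_multipart; set m := (x + _)%MM.
have dm : mdeg m = (mdeg x + p)%N by rewrite mdegD mdeg_mesym1 cb.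
have [E|nE] := eqVneq (mdeg m) q.
  have [zs <-] := zfP m E; apply: eq_bd => A; rewrite /multipart WE.
  case: ifP => [le|nle]; first by rewrite -mdeg_mesym1 -mdegD submK // E eqxx.
  by apply/esym/eqP; apply: contraFT nle => /zs[/andP[]].
rewrite /bd big1 => [|i ib].
  apply/esym/eqP; apply: contraNT nE; rewrite multipartD.
  by move=> nz; have [_ <-] := (tensor_chainP _ _).1 Lv _ _ nz; rewrite dm.
rewrite {1}/multipart WE; case: ifP => [le|_]; last by rewrite mulr0.
by rewrite -mdeg_mesym1 -mdegD submK // (negbTE nE) mulr0.
Qed.

(** A scalar cycle lifts to the chain with terms c_A x^(m - A); the multidegree [m] part of a
    polynomial filling then fills it. *)
Lemma acyclic_of_betti m p :
  graded_betti L p (mdeg m) 0 -> acyclic K (face M m) p.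
Proof.
move=> [z [_ _ Hz]] c cs c0.
pose w A : S := c A *: 'X_[m - mesym1 A].
pose v := KoszulExact.res p w : chains p.
have extE A : KoszulExact.ext v A = w A.
  have [/eqP cA|nA] := eqVneq #|A| p; last first.
    rewrite KoszulExact.ext_out // /w.
    have [->|/cs[_ E]] := eqVneq (c A) 0; first by rewrite scale0r.
    by rewrite E eqxx in nA.
  by rewrite (ext_Sub _ cA) ffunE SubK.
have cf A : c A != 0 -> (mesym1 A <= m)%MM by move=> /cs[/andP[]].
have partE m' A : multipart (KoszulExact.ext v) m' A = if m' == m then c A else 0.
  rewrite /multipart extE mcoeffZ mcoeffX.
  have [->|nz] := eqVneq (c A) 0; first by rewrite mul0r !if_same.
  have Am := cf A nz; have [->|ne] := eqVneq m' m; first by rewrite Am eqxx mulr1.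
  case: ifP => // Am'; case: eqP => [E|_]; rewrite ?mulr0 //.
  by case/eqP: ne; rewrite -(submK Am') -(submK Am) E.
have vcyc : tensor_cycle L (mdeg m) v.
  apply/tensor_cycleP; split=> [|B].
    apply/tensor_chainP => A x; rewrite extE mcoeffZ mcoeffX mulf_eq0 negb_or.
    case/andP=> nz; have [<- _|_] := eqVneq (m - mesym1 A)%MM x; last by rewrite eqxx.
    have [/andP[Am MA] <-] := cs A nz; split=> //.
    by rewrite -mdeg_mesym1 -mdegD submK.
  apply/mpolyP => x; rewrite -multipartD -bd_multipart mcoeff0.
  rewrite (eq_bd (partE _)); case: eqP => [_|_]; first exact: c0.
  by rewrite /bd big1 // => i _; rewrite mulr0.
have [c1] := Hz v vcyc; rewrite big_ord0 subr0 => -[u [Lu du]].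
exists (multipart (KoszulExact.ext u) m); first exact: supported_multipart Lu.
have DE B : KoszulExact.D (KoszulExact.ext u) B = KoszulExact.ext v B.
  have [/eqP cB|nB] := eqVneq #|B| p; last first.
    by rewrite KoszulExact.D_ext_out ?KoszulExact.ext_out.
  by rewrite (ext_Sub v cB) -du KoszulExact.diff_ext ffunE SubK.
move=> B; rewrite bd_multipart /multipart DE.
by have := partE m B; rewrite eqxx /multipart.
Qed.

End KoszulMultigraded.

(** * Weighted edge ideals *)

Section MonomialIdeals.
Import GRing.Theory.
Local Open Scope ring_scope.
Variables (K : fieldType) (n : nat).
Notation S := {mpoly K[n]}.
Implicit Types (f g : S) (X : S -> Prop) (m u x y : 'X_{1..n}).

Lemma ideal_gen_supp X (Q : 'X_{1..n} -> Prop) f :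
  (forall x y, (x <= y)%MM -> Q x -> Q y) ->
  (forall g, X g -> forall m, g@_m != 0 -> Q m) ->
  ideal_gen X f -> forall m, f@_m != 0 -> Q m.
Proof.
move=> uQ XQ [r [c [g [Xg ->]]]] m; rewrite raddf_sum /=.
have [/existsP[k nz] _|none] := boolP [exists k, (c k * g k)@_m != 0].
  move: nz; rewrite -mcoeff_msupp => /msuppM_le/allpairsP[[m1 m2] /= [_ m2g ->]].
  by apply: uQ (XQ _ (Xg k) m2 _); rewrite ?lem_addl // -mcoeff_msupp.
rewrite big1 ?eqxx // => k _; apply/eqP/negPn.
by move: none; rewrite negb_exists => /forallP.
Qed.

Lemma mem_ideal_gen X f :
  (forall m, f@_m != 0 -> exists2 u, (u <= m)%MM & X 'X_[u]) -> ideal_gen X f.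
Proof.
move=> H; pose s := msupp f; pose mk (k : 'I_(size s)) := nth 0%MM s k.
have /fin_all_exists2[u u_le Xu] (k : 'I_(size s)) :
    exists2 u, (u <= mk k)%MM & X 'X_[u].
  by apply: H; rewrite -mcoeff_msupp mem_nth.
exists (size s), (fun k => f@_(mk k) *: 'X_[mk k - u k]), (fun k => 'X_[u k]).
split=> //; rewrite {1}[f]mpolyE (big_nth 0%MM) big_mkord.
by apply: eq_bigr => k _; rewrite -scalerAl -mpolyXD submK.
Qed.

Lemma lepm_interpolate x m d : (x <= m)%MM -> (mdeg x <= d <= mdeg m)%N ->
  exists y, [/\ (x <= y)%MM, (y <= m)%MM & mdeg y = d].
Proof.
have [k] := ubnP (d - mdeg x); elim: k x => // k IH x ltk xm /andP[xd dm].
have [E|ne] := eqVneq (mdeg x) d; first by exists x; rewrite lepm_refl.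
have [/existsP[i lt]|none] := boolP [exists i, (x i < m i)%N]; last first.
  suff : (mdeg m <= mdeg x)%N by lia.
  rewrite !mdegE; apply: leq_sum => i _; rewrite leqNgt.
  by move: none; rewrite negb_exists => /forallP.
have [||| y [xy ym dy]] := IH (x + U_(i))%MM.
- by rewrite mdegD mdeg1; lia.
- apply/mnm_lepP => j; rewrite mnmDE mnm1E; move/mnm_lepP/(_ j): xm.
  by case: eqP => [<-|]; lia.
- by rewrite mdegD mdeg1; lia.
by exists y; split=> //; apply: lepm_trans xy; apply: lem_addr.
Qed.

Lemma lepm_mdeg x y : (x <= y)%MM -> (mdeg x <= mdeg y)%N.
Proof. by move=> xy; rewrite -(submK xy) mdegD leq_addl. Qed.

Lemma lepm_eq x y : (x <= y)%MM -> (mdeg y <= mdeg x)%N -> x = y.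
Proof.
move=> xy dyx; rewrite -[RHS](submK xy); suff /eqP -> : (y - x)%MM == 0%MM by rewrite add0m.
by rewrite -mdeg_eq0; have := mdegD (y - x) x; rewrite submK //; lia.
Qed.

End MonomialIdeals.

(** * Degree components of weighted edge ideals *)

Section EdgeIdeals.
Import GRing.Theory.
Local Open Scope ring_scope.
Variables (K : fieldType) (n : nat) (e : rel 'I_n) (a : 'I_n -> nat).
Hypothesis e_irr : irreflexive e.
Notation S := {mpoly K[n]}.
Implicit Types (f g : S) (m u x y : 'X_{1..n}) (r : rel 'I_n) (i j k l : 'I_n).

Lemma edge_neq i j : e i j -> i != j.
Proof. by apply: contraTneq => ->; rewrite e_irr. Qed.

Definition pair_mnm i j : 'X_{1..n} := (U_(i) *+ a i + U_(j) *+ a j)%MM.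

Lemma pair_mnmE i j k : pair_mnm i j k = ((i == k) * a i + (j == k) * a j)%N.
Proof. by rewrite mnmDE !mulmnE !mnm1E. Qed.

Lemma pair_mnm_le i j m : i != j ->
  (pair_mnm i j <= m)%MM = (a i <= m i)%N && (a j <= m j)%N.
Proof.
move=> ij; apply/mnm_lepP/andP => [H|[ai aj] k].
  by have := H i; have := H j; rewrite !pair_mnmE !eqxx (negbTE ij) [j == i]eq_sym (negbTE ij); lia.
rewrite pair_mnmE; have [<-|ik] := eqVneq i k.
  by rewrite eq_sym (negbTE ij); lia.
by have [<-|jk] := eqVneq j k; lia.
Qed.

Lemma pair_mnm_gel i j : (a i <= pair_mnm i j i)%N.
Proof. by rewrite pair_mnmE eqxx mul1n leq_addr. Qed.

Lemma pair_mnm_ger i j : (a j <= pair_mnm i j j)%N.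
Proof. by rewrite pair_mnmE eqxx mul1n leq_addl. Qed.

Lemma mdeg_pair_mnm i j : mdeg (pair_mnm i j) = (a i + a j)%N.
Proof. by rewrite mdegD !mdegMn !mdeg1; lia. Qed.

(** For [i != j] the two separate tests amount to divisibility by [pair_mnm i j]. Symmetry of [r] is
    not asked for, so an edge may be listed in one orientation. *)
Definition edge_mons r : pred 'X_{1..n} :=
  fun m => [exists i, exists j, [&& r i j, a i <= m i & a j <= m j]]%N.

Lemma edge_monsP r m : reflect
  (exists i j, [/\ r i j, (a i <= m i)%N & (a j <= m j)%N]) (edge_mons r m).
Proof.
apply: (iffP existsP) => [[i /existsP[j /and3P[rij ai aj]]]|[i [j [rij ai aj]]]].
  by exists i, j.
by exists i; apply/existsP; exists j; rewrite rij ai aj.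
Qed.

Lemma edge_mons_up r : up_closed (edge_mons r).
Proof.
move=> x y /mnm_lepP xy /edge_monsP[i [j [rij ai aj]]]; apply/edge_monsP.
by exists i, j; split=> //; [apply: leq_trans ai _|apply: leq_trans aj _].
Qed.

Lemma edge_idealP f : edge_ideal K e f <->
  forall m, f@_m != 0 -> exists i j, e i j /\ (U_(i) + U_(j) <= m)%MM.
Proof.
split.
  apply: ideal_gen_supp => [x y xy [i [j [eij le]]]|g [i [j [eij ->]]] m].
    by exists i, j; split=> //; apply: lepm_trans xy.
  rewrite -mpolyXD mcoeffX; have [<-|] := eqVneq (U_(i) + U_(j))%MM m; last by rewrite eqxx.
  by exists i, j; rewrite lepm_refl.
move=> H; apply: mem_ideal_gen => m /H[i [j [eij le]]].
by exists (U_(i) + U_(j))%MM => //; exists i, j; rewrite mpolyXD.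
Qed.

Lemma edge_ideal_mon u :
  edge_ideal K e 'X_[u] <-> exists i j, e i j /\ (U_(i) + U_(j) <= u)%MM.
Proof.
rewrite edge_idealP; split=> [/(_ u)|H m]; first by rewrite mcoeffX eqxx oner_eq0; apply.
by rewrite mcoeffX; have [<-|] := eqVneq u m; rewrite ?eqxx.
Qed.

Lemma min_gens_edge u :
  min_gens (edge_ideal K e) u <-> exists i j, e i j /\ u = (U_(i) + U_(j))%MM.
Proof.
split=> [[/edge_ideal_mon[i [j [eij le]]] min]|[i [j [eij ->]]]].
  exists i, j; split=> //; apply/esym/min => //; apply/edge_ideal_mon.
  by exists i, j; rewrite lepm_refl.
split=> [|m /edge_ideal_mon[k [l [_ le]]] le_m].
  by apply/edge_ideal_mon; exists i, j; rewrite lepm_refl.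
apply: lepm_eq => //; apply: leq_trans (lepm_mdeg le).
by rewrite !mdegD !mdeg1.
Qed.

Lemma mnm_bracket_edge i j : i != j ->
  mnm_bracket a (U_(i) + U_(j))%MM = pair_mnm i j.
Proof.
move=> ij; apply/mnmP => k; rewrite pair_mnmE mnmE mnmDE !mnm1E mulnDr.
by rewrite ![(a k * _)%N]mulnC; case: eqP => [->|_]; case: eqP => [->|_].
Qed.

Lemma bracket_idealP f : ideal_bracket a (edge_ideal K e) f <->
  forall m, f@_m != 0 -> edge_mons e m.
Proof.
split.
  apply: ideal_gen_supp => [|g [u [/min_gens_edge[i [j [eij ->]]] ->]] m].
    exact: edge_mons_up.
  have ij := edge_neq eij; rewrite mnm_bracket_edge // mcoeffX.
  have [<- _|] := eqVneq (pair_mnm i j) m; last by rewrite eqxx.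
  apply/edge_monsP; exists i, j; split=> //; have := lepm_refl (pair_mnm i j);
  by rewrite pair_mnm_le // => /andP[].
move=> H; apply: mem_ideal_gen => m /H/edge_monsP[i [j [eij ai aj]]].
have ij := edge_neq eij; exists (pair_mnm i j); first by rewrite pair_mnm_le // ai aj.
exists (U_(i) + U_(j))%MM; rewrite mnm_bracket_edge //; split=> //.
by apply/min_gens_edge; exists i, j.
Qed.

Definition low_edge d : rel 'I_n := [rel i j | e i j && (a i + a j <= d)%N].

Definition component_mons d : pred 'X_{1..n} :=
  fun m => (d <= mdeg m)%N && edge_mons (low_edge d) m.

(** Between a generator of degree at most [d] and a multiple of it of degree at least [d] lies a
    monomial of degree exactly [d]. *)
Lemma degree_componentP d f :
  degree_component (ideal_bracket a (edge_ideal K e)) d f <->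
  forall m, f@_m != 0 -> component_mons d m.
Proof.
split.
  apply: ideal_gen_supp => [x y xy|g [/bracket_idealP Ig /dhomogP hg] m nz].
    rewrite /component_mons => /andP[dx ex]; rewrite (edge_mons_up xy ex) andbT.
    exact: leq_trans dx (lepm_mdeg xy).
  have /edge_monsP[i [j [eij ai aj]]] := Ig m nz.
  have dm : mdeg m = d by apply: hg; rewrite mcoeff_msupp.
  rewrite /component_mons dm leqnn; apply/edge_monsP; exists i, j; split=> //.
  rewrite /low_edge /= eij -mdeg_pair_mnm -dm; apply: lepm_mdeg.
  by rewrite pair_mnm_le ?edge_neq // ai aj.
move=> H; apply: mem_ideal_gen => m /H/andP[dm /edge_monsP[i [j [/andP[eij ed] ai aj]]]].
have ij := edge_neq eij.
have [||u [pu um du]] := @lepm_interpolate n (pair_mnm i j) m d.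
- by rewrite pair_mnm_le // ai aj.
- by rewrite mdeg_pair_mnm ed dm.
exists u => //; split; last by rewrite dhomogX /= du.
apply/bracket_idealP => x; rewrite mcoeffX.
have [<- _|] := eqVneq u x; last by rewrite eqxx.
by apply/edge_monsP; exists i, j; move: pu; rewrite pair_mnm_le // => /andP[].
Qed.

Lemma componentwise_linearP :
  componentwise_linear (ideal_bracket a (edge_ideal K e)) <->
  forall d m p, mdeg m <> (p + d)%N -> acyclic K (face (component_mons d) m) p.
Proof.
split=> [cwl d m p ne|ac d].
  have [_ betti] := cwl d; apply: acyclic_of_betti (betti p _ ne).
  exact: degree_componentP.
split=> [|p q ne].
  by exists (fun f => ideal_bracket a (edge_ideal K e) f /\ f \is d.-homog) => [f []|].
apply: (betti_of_acyclic (degree_componentP d)) => m dm.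
by apply: ac; rewrite dm.
Qed.

(** If deg m > p + d, truncating in degree [d] loses no face with [p] or [p.+1] elements; if deg m <
    p + d, no face with [p] elements survives it. *)
Lemma componentwise_linear_reg : (forall d, reg_le K (edge_mons (low_edge d)) d) ->
  componentwise_linear (ideal_bracket a (edge_ideal K e)).
Proof.
move=> reg; apply/componentwise_linearP => d m p ne.
have [lt|ge] := ltnP (p + d) (mdeg m).
  apply: (acyclic_mono (D := face (edge_mons (low_edge d)) m)); last exact: reg.
    move=> A pA /andP[Am MA]; rewrite /face /component_mons Am MA andbT.
    by have := mdegD (m - mesym1 A) (mesym1 A); rewrite submK // mdeg_mesym1; lia.
  by move=> A _ /and3P[Am _ MA]; rewrite /face Am.
apply: acyclic_empty => A pA; apply/negP => /and3P[Am dm _].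
by have := mdegD (m - mesym1 A) (mesym1 A); rewrite submK // mdeg_mesym1; lia.
Qed.

End EdgeIdeals.

(** * Sufficiency *)

Section Regularity.
Variables (K : fieldType) (n : nat) (e : rel 'I_n) (a : 'I_n -> nat).
Hypotheses (e_sym : symmetric e) (e_irr : irreflexive e).
Hypotheses (e_chordal : chordal (compl_graph e)) (a_pos : forall i, 0 < a i).
Implicit Types (m u x y : 'X_{1..n}) (r : rel 'I_n) (i j k l v : 'I_n).
Implicit Types (W : {set 'I_n}).

Local Notation h := (compl_graph e).

Lemma complE i j : h i j = (i != j) && ~~ e i j.
Proof. by []. Qed.

Lemma compl_sym : symmetric h.
Proof. by move=> i j; rewrite !complE eq_sym e_sym. Qed.

Lemma compl_irr : irreflexive h.
Proof. by move=> i; rewrite complE eqxx. Qed.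

(** Otherwise [i, k, j, l] is a 4-cycle of the complement without a chord, [i j] and [k l] being
    edges of [e]. *)
Lemma two_K2_free i j k l : e i j -> e k l -> k != i -> k != j -> l != i -> l != j ->
  [|| e i k, e i l, e j k | e j l].
Proof.
move=> eij ekl ki kj li lj; apply: contraT; rewrite !negb_or.
case/and4P=> nik nil njk njl.
have hc (x y : 'I_n) : x != y -> ~~ e x y -> h x y by rewrite complE => -> ->.
have ij := edge_neq e_irr eij; have kl := edge_neq e_irr ekl.
pose c := [:: i; k; j; l].
have uc : uniq c.
  by rewrite /= !inE !negb_or ![i == _]eq_sym [j == l]eq_sym ki li lj kj kl eq_sym ij.
have [||x [y [xc yc]]] := e_chordal (c := c) => //.
  rewrite /ucycle uc andbT /=; apply/and5P; split=> //; apply: hc => //; rewrite 1?eq_sym //.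
    by rewrite e_sym.
  by rewrite e_sym.
rewrite complE.
have neq := (negbTE ij, eq_sym j k, eq_sym j i, eq_sym l k, negbTE kl, negbTE kj).
move: xc yc; rewrite !inE => /or4P[]/eqP-> /or4P[]/eqP->; rewrite ?eqxx ?eij ?ekl ?andbF //
  ?[e j i]e_sym ?[e l k]e_sym ?eij ?ekl ?andbF //=;
  rewrite ?eqxx ?(negbTE ki) ?(negbTE kj) ?(negbTE li) ?(negbTE lj) ?eqxx ?neq ?eqxx //.
Qed.

(* In the colon ideal by [x_v x_j], an edge [k l] away from [j] is absorbed
   by the endpoint that [rk] eliminates before [j]: it is adjacent to [v],
   because [v] is eliminated last. *)
Lemma edge_before (rk : 'I_n -> nat) v j k l :
  injective rk -> (forall k, k != v -> rk k < rk v) -> elimination_rank h setT rk ->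
  e v j -> e k l -> k != v -> l != v -> k != j -> l != j -> ~~ e j k -> ~~ e j l ->
  e v k && (rk k < rk j) || e v l && (rk l < rk j).
Proof.
move=> inj last el evj ekl kv lv kj lj njk njl.
have vj := edge_neq e_irr evj.
have adj t : t != v -> t != j -> ~~ e j t -> rk t < rk j -> e v t.
  move=> tv tj njt lt; apply: contraT => nvt.
  have := el t j v; rewrite !inE lt last // !complE tj tv !(e_sym t) njt nvt.
  by rewrite eq_sym vj e_sym evj => /(_ isT isT isT isT isT isT isT isT).
have [lt|ge] := ltnP (rk k) (rk j); first by rewrite adj.
have [lt|ge'] := ltnP (rk l) (rk j); first by rewrite [e v l]adj ?orbT.
have := el j k l; rewrite !inE !complE njk njl ekl ![j == _]eq_sym kj lj.
rewrite !ltn_neqAle ge ge' !(inj_eq inj) ![j == _]eq_sym kj lj (edge_neq e_irr ekl).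
by move=> /(_ isT isT isT isT isT isT isT isT).
Qed.

Definition induced W : rel 'I_n := [rel i j | [&& e i j, i \in W & j \in W]].

(** The generators at [v] enter by increasing rank of [j]. The colon ideal at [j] is generated by
    the variables of the neighbours of [j] in [W] and of the earlier elements of [T]; [before]
    treats the edges away from [j] and its neighbours. [T] may omit neighbours of [v], as happens
    under (C). *)
Lemma reg_add_vertex W v (T : {set 'I_n}) (rk : 'I_n -> nat) d :
    injective rk -> v \notin W -> T \subset W -> a v < d ->
    (forall j, j \in T -> [/\ e v j, a j = 1 & forall k, k \in W -> e j k -> a k = 1]) ->
    (forall j k l, j \in T -> k \in W -> l \in W -> e k l -> k != j -> l != j ->
       ~~ e j k -> ~~ e j l ->
       (k \in T) && (rk k < rk j) || (l \in T) && (rk l < rk j)) ->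
    reg_le K (edge_mons a (induced W)) d ->
  reg_le K (edge_mons a [rel i j | induced W i j || (i == v) && (j \in T)]) d.
Proof.
move=> inj vW TW avd TP before regW.
pose r s : rel 'I_n := [rel i j | induced W i j || [&& i == v, j \in T & rk j < s]].
have regr s : reg_le K (edge_mons a (r s)) d.
  elim: s => [|s IH].
    apply: eq_reg regW => x; apply: eq_existsb => i; apply: eq_existsb => j.
    by rewrite /r /= ltn0 !andbF orbF.
  (* As [rk] is injective, at most one generator enters at stage [s]. *)
  have [/existsP[j /andP[jT /eqP rkj]]|none] := boolP [exists j, (j \in T) && (rk j == s)].
    have jW := subsetP TW j jT; have [evj aj jnb] := TP j jT.
    have vj := edge_neq e_irr evj.
    pose u := pair_mnm a v j.
    apply: (@eq_reg _ _ (fun x => edge_mons a (r s) x || (u <= x)%MM)).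
      move=> x; rewrite pair_mnm_le //.
      apply/orP/edge_monsP => [[/edge_monsP[k [l [rkl ak al]]]|/andP[av aj']]|].
      - exists k, l; split=> //; case/orP: rkl => [kl|/and3P[kv lT lt]]; apply/orP.
          by left.
        by right; apply/and3P; split=> //; apply: leqW.
      - exists v, j; split=> //; apply/orP; right; apply/and3P; split=> //.
        by rewrite rkj.
      move=> [k [l [/orP[kl|/and3P[/eqP kv lT lt]] ak al]]].
        by left; apply/edge_monsP; exists k, l; split=> //; apply/orP; left.
      move: lt; rewrite ltnS leq_eqVlt -rkj (inj_eq inj) => /orP[/eqP lj|lt].
        by right; rewrite -kv -lj ak al.
      left; apply/edge_monsP; exists k, l; split=> //; apply/orP; right.
      by apply/and3P; split; rewrite ?kv // -rkj.
    apply: reg_add_gen => //; first exact: edge_mons_up.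
      by rewrite mdeg_pair_mnm aj addn1.
    move=> x Mx.
    (* [u] involves only [v] and [j], so the exponent of any other vertex comes from [x]. *)
    have out t : t != v -> t != j -> a t <= (u + x)%MM t -> 0 < x t.
      move=> tv tj; rewrite /u mnmDE pair_mnmE ![_ == t]eq_sym (negbTE tv) (negbTE tj).
      exact: leq_trans.
    have newT t : t \in T -> rk t < rk j -> edge_mons a (r s) (u + U_(t))%MM.
      move=> tT lt; apply/edge_monsP; exists v, t.
      have [_ -> _] := TP t tT; rewrite ![(_ + U_(_))%MM _]mnmDE !mnm1E eqxx addn1.
      split=> //; last by apply: leq_trans (leq_addr _ _); apply: pair_mnm_gel.
      by apply/orP; right; apply/and3P; split=> //; rewrite -rkj.
    have newJ t : t \in W -> e j t -> edge_mons a (r s) (u + U_(t))%MM.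
      move=> tW ejt; apply/edge_monsP; exists j, t.
      rewrite (jnb t) // ![(_ + U_(_))%MM _]mnmDE !mnm1E eqxx addn1.
      split=> //; last by apply: leq_trans (leq_addr _ _); apply: pair_mnm_ger.
      by apply/orP; left; apply/and3P.
    have Wv t : t \in W -> t != v by apply: contraTneq => ->.
    have /edge_monsP[k [l [/orP[/and3P[ekl kW lW]|/and3P[/eqP -> lT lt]] ak al]]] := Mx.
      have [kj|kj] := eqVneq k j.
        exists l; last by apply: newJ; rewrite // -kj.
        by apply: out; rewrite ?Wv // -kj eq_sym (edge_neq e_irr ekl).
      have xk : 0 < x k by apply: out; rewrite ?Wv.
      have [lj|lj] := eqVneq l j.
        by exists k => //; apply: newJ; rewrite // e_sym -lj.
      have xl : 0 < x l by apply: out; rewrite ?Wv.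
      have [ejk|njk] := boolP (e j k); first by exists k => //; apply: newJ.
      have [ejl|njl] := boolP (e j l); first by exists l => //; apply: newJ.
      case/orP: (before j k l jT kW lW ekl kj lj njk njl) => /andP[tT lt].
        by exists k => //; apply: newT.
      by exists l => //; apply: newT.
    exists l; last by apply: newT; rewrite ?rkj.
    apply: out => //; first by rewrite Wv // (subsetP TW).
    by apply: contraTneq lt => ->; rewrite rkj ltnn.
  apply: eq_reg IH => x; apply: eq_existsb => i; apply: eq_existsb => j.
  congr (_ && _); rewrite /r /=; congr (_ || (_ && _)).
  have [jT|//] := boolP (j \in T); rewrite /= ltnS [RHS]leq_eqVlt.
  case: eqP => // E; case/negP: none; apply/existsP; exists j.
  by rewrite jT E eqxx.
apply: eq_reg (regr (\max_i rk i).+1) => x; apply: eq_existsb => i; apply: eq_existsb => j.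
by congr (_ && _); rewrite /r /= ltnS (leq_bigmax j) andbT.
Qed.

(** Condition (B) relative to [W]. *)
Definition sparse W :=
  (forall i j, i \in W -> j \in W -> 1 < a i -> 1 < a j -> ~~ e i j) /\
  (forall i j k, i \in W -> j \in W -> k \in W -> 1 < a i -> 1 < a j -> i != j ->
     ~~ (e i k && e j k)).

Lemma reg_sparse W d : sparse W -> (forall k, k \in W -> a k < d) ->
  reg_le K (edge_mons a (induced W)) d.
Proof.
have [c] := ubnP #|W|; elim: c W => // c IH W ltW [ind disj] Wd.
have [->|[w wW]] := set_0Vmem W.
  apply: eq_reg (@reg_empty K n d) => x; apply/esym/negbTE/negP => /edge_monsP[i [j []]].
  by case/and3P; rewrite inE.
(* Vertices of weight at least 2 are removed first, hence added last; a [v] of weight 1 is taken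
   only when all weights on [W] are 1. *)
have [v [vW vP]] : exists v, v \in W /\ (a v = 1 -> forall k, k \in W -> a k = 1).
  have [/existsP[v /andP[vW av]]|none] := boolP [exists v, (v \in W) && (1 < a v)].
    by exists v; split=> // E; rewrite E in av.
  exists w; split=> // _ k kW; apply/eqP; rewrite eqn_leq a_pos andbT leqNgt.
  by apply: contra none => ak; apply/existsP; exists k; rewrite kW.
have one k : ~~ (1 < a k) -> a k = 1 by have := a_pos k; lia.
have [rk [inj lst el]] := elimination_rank_last compl_sym compl_irr e_chordal v.
pose W' := W :\ v; pose T := [set j in W' | e v j].
have TW : T \subset W' by apply/subsetP => j; rewrite inE => /andP[].
have WW t : t \in W' -> t \in W by rewrite inE => /andP[].
have Wv t : t \in W' -> t != v by rewrite !inE => /andP[].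
have a1 j : j \in T -> a j = 1.
  move=> jT; have jW := WW j (subsetP TW j jT); move: jT; rewrite inE => /andP[_ evj].
  have [av|/one/vP] := boolP (1 < a v); last by apply.
  by apply: one; apply: contraL evj => aj; apply: ind.
apply: (@eq_reg _ _ (edge_mons a [rel i j | induced W' i j || (i == v) && (j \in T)])).
  move=> x; apply/edge_monsP/edge_monsP => -[i [j [rij ai aj]]].
    exists i, j; split=> //; apply/and3P.
    case/orP: rij => [/and3P[eij /WW iW /WW jW]|/andP[/eqP -> jT]] //.
    by move: jT; rewrite inE => /andP[/WW jW evj].
  case/and3P: rij => eij iW jW; have ij := edge_neq e_irr eij.
  have [iv|iv] := eqVneq i v.
    exists i, j; split=> //; apply/orP; right; apply/andP; split; first exact/eqP.
    by rewrite !inE -iv eq_sym ij jW.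
  have [jv|jv] := eqVneq j v.
    exists j, i; split=> //; apply/orP; right; apply/andP; split; first exact/eqP.
    by rewrite !inE -jv ij iW e_sym.
  exists i, j; split=> //; apply/orP; left; apply/and3P.
  by rewrite !inE iv jv.
apply: (reg_add_vertex inj) => //.
- by rewrite !inE eqxx.
- exact: Wd.
- move=> j jT; have jW := subsetP TW j jT; split; [|exact: a1|].
    by move: jT; rewrite inE => /andP[].
  move=> k kW ejk; have [av|/one/vP] := boolP (1 < a v); last by apply; apply: WW.
  apply: one; apply/negP => ak; have vk : v != k by rewrite eq_sym Wv.
  case/negP: (disj v k j vW (WW k kW) (WW j jW) av ak vk).
  by rewrite [e k j]e_sym ejk andbT; move: jT; rewrite inE => /andP[].
- move=> j k l jT kW lW ekl kj lj njk njl; rewrite !inE !(Wv, WW, kW, lW) //= .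
  have := edge_before inj lst el (j := j) (k := k) (l := l).
  by apply; rewrite ?Wv //; move: jT; rewrite inE => /andP[].
apply: IH.
- by move: ltW; rewrite (cardsD1 v W) vW add1n ltnS.
- by split=> [i j /WW iW /WW jW|i j k /WW iW /WW jW /WW kW]; [apply: ind|apply: disj].
- by move=> k /WW; apply: Wd.
Qed.

End Regularity.

(** * Componentwise linearity under (B) and under (C) *)

Section Sufficiency.
Variables (K : fieldType) (n : nat) (e : rel 'I_n) (a : 'I_n -> nat).
Hypotheses (e_sym : symmetric e) (e_irr : irreflexive e).
Hypotheses (e_chordal : chordal (compl_graph e)) (a_pos : forall i, 0 < a i).
Implicit Types (m u x y : 'X_{1..n}) (r : rel 'I_n) (i j k l v : 'I_n).
Implicit Types (W : {set 'I_n}).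
Local Notation light d := [set k | a k < d].

Lemma eq_edge_mons r r' : r =2 r' -> edge_mons a r =1 edge_mons a r'.
Proof.
by move=> E x; apply: eq_existsb => i; apply: eq_existsb => j; rewrite E.
Qed.

Lemma cwl_sparse : sparse e a setT ->
  componentwise_linear (ideal_bracket a (edge_ideal K e)).
Proof.
move=> sp; apply: componentwise_linear_reg => // d.
apply: eq_reg (reg_sparse e_sym e_irr e_chordal a_pos (W := light d) (d := d) _ _).
(* Every edge has an end of weight 1, so [a i + a j <= d] holds exactly when both weights are below
   [d]. *)
- apply: eq_edge_mons => i j; rewrite /low_edge /induced /= !inE.
  have [eij|//] := boolP (e i j); have := sp.1 i j; rewrite !inE eij.
  by have := a_pos i; have := a_pos j; lia.
- split=> [i j _ _|i j k _ _ _]; first by apply: sp.1; rewrite inE.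
  by apply: sp.2; rewrite inE.
- by move=> k; rewrite inE.
Qed.

Lemma cwl_pair i j : e i j -> 1 < a i -> 1 < a j ->
  (forall k, k != i -> k != j -> a k = 1) ->
  (forall k, e i k -> e j k -> False) ->
  (forall k l, e i k -> e j l -> e k l) ->
  componentwise_linear (ideal_bracket a (edge_ideal K e)).
Proof.
move=> eij ai aj others disj full; have ij := edge_neq e_irr eij.
pose r d : rel 'I_n := [rel k l | induced e (light d) k l &&
  (~~ ((k == i) && (l == j)) && ~~ ((k == j) && (l == i)))].
have regr d : reg_le K (edge_mons a (r d)) d.
  (* A set missing [i] or [j] has at most one vertex of weight at least 2, hence is sparse. *)
  have regW W : (forall k, k \in W -> a k < d) -> ~~ ((i \in W) && (j \in W)) ->
      reg_le K (edge_mons a (induced e W)) d.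
    move=> Wd nij; apply: reg_sparse => //.
    have one k l : k \in W -> l \in W -> 1 < a k -> 1 < a l -> k = l.
      move=> kW lW ak al.
      have kij : (k == i) || (k == j).
        by apply: contraTT ak => /norP[ki kj]; rewrite (others k).
      have lij : (l == i) || (l == j).
        by apply: contraTT al => /norP[ki kj]; rewrite (others l).
      move: kW lW nij; case/orP: kij => /eqP->; case/orP: lij => /eqP-> // -> ->; by [].
    split=> [k l kW lW ak al|k l t kW lW _ ak al /eqP[]]; last exact: one.
    by rewrite (one k l) ?e_irr.
  have [ijd|nij] := boolP ((i \in light d) && (j \in light d)); last first.
    apply: eq_reg (regW (light d) _ nij); last by move=> k; rewrite inE.
    apply: eq_edge_mons => k l; rewrite /r /=.
    have [/and3P[_ kW lW]|//] := boolP (induced e (light d) k l).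
    apply/esym; rewrite -negb_or; apply: contra nij.
    by case/orP=> /andP[/eqP<- /eqP<-]; rewrite kW lW.
  (* When [i] and [j] are both light, [j] is added last, joined to its light neighbours other than
     [i]. *)
  pose W := light d :\ j; pose T := [set k in W | e j k && (k != i)].
  have [rk [inj lst el]] :=
    elimination_rank_last (compl_sym e_sym) (@compl_irr n e) e_chordal j.
  have Tone t : t \in T -> a t = 1 /\ e j t.
    by rewrite !inE => /andP[/andP[tj _] /andP[-> ti]]; rewrite others.
  have WT : T \subset W by apply/subsetP => t; rewrite inE => /andP[].
  have /andP[id jd] := ijd.
  apply: (@eq_reg _ _ (edge_mons a [rel k l | induced e W k l || (k == j) && (l \in T)])).
    move=> x; apply/edge_monsP/edge_monsP => -[k [l [rkl ak al]]].
      exists k, l; split=> //.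
      case/orP: rkl => [/and3P[ekl]|/andP[/eqP -> lT]].
        rewrite !in_setD1 => /andP[kj kd] /andP[lj ld].
        by rewrite /r /= /induced /= ekl kd ld (negbTE kj) (negbTE lj) andbF.
      move: (lT); rewrite in_set in_setD1 => /andP[/andP[lj ld] /andP[ejl li]].
      by rewrite /r /= /induced /= ejl jd ld (negbTE lj) (negbTE li) !andbF.
    case/andP: rkl => /and3P[ekl kd ld] nkl.
    have kl := edge_neq e_irr ekl.
    have [kj|kj] := eqVneq k j.
      exists k, l; split=> //; apply/orP; right.
      rewrite kj eqxx in_set in_setD1 ld -kj eq_sym kl ekl.
      by case/andP: nkl => _; rewrite kj eqxx.
    have [lj|lj] := eqVneq l j.
      exists l, k; split=> //; apply/orP; right.
      rewrite lj eqxx in_set in_setD1 kd kj -lj e_sym ekl.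
      by case/andP: nkl; rewrite lj eqxx andbT => ->.
    exists k, l; split=> //; apply/orP; left; apply/and3P.
    by rewrite !in_setD1 kj lj.
  apply: (reg_add_vertex e_sym e_irr a_pos inj) => //.
  - by rewrite !inE eqxx.
  - by move: jd; rewrite inE.
  - move=> t tT; have [at1 ejt] := Tone t tT; split=> // k; rewrite in_setD1 => /andP[kj _] etk.
    by apply: others => //; apply/eqP => ki; apply: (disj t) => //; rewrite -ki e_sym.
  - move=> t k l tT kW lW ekl kt lt ntk ntl; have [_ ejt] := Tone t tT.
    have Wj (s : 'I_n) : s \in W -> s != j by rewrite in_setD1 => /andP[].
    have inT (s : 'I_n) : s \in W -> s != i -> (s \in T) = e j s.
      by move=> sW si; rewrite in_set sW si andbT.
    (* If one end of [k l] were [i], the other would be adjacent to [t] by [full]. *)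
    have ki : k != i by apply: contraNneq ntl => ki; rewrite e_sym full // -ki.
    have li : l != i by apply: contraNneq ntk => li; rewrite e_sym full // -li e_sym.
    have := edge_before e_sym e_irr inj lst el ejt ekl (Wj k kW) (Wj l lW) kt lt ntk ntl.
    by rewrite !inT.
  apply: regW; first by move=> k; rewrite in_setD1 inE => /andP[].
  by rewrite negb_and !in_setD1 eqxx orbT.
apply: componentwise_linear_reg => // d.
(* Every edge other than [i j] has an end of weight 1. *)
have rE k l : r d k l = e k l && ~~ ((k == i) && (l == j) || (k == j) && (l == i)) &&
    (a k + a l <= d).
  rewrite /r /= /induced /= !inE negb_or -andbA; have [ekl|//] := boolP (e k l).
  rewrite /= -negb_or; case: (boolP (_ || _)) => [_|npair]; first by rewrite andbF.
  have kl := edge_neq e_irr ekl.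
  have ak := a_pos k; have al := a_pos l.
  have [ak1|al1] : a k = 1 \/ a l = 1; [|lia..].
  have big s : [\/ a s = 1, s = i | s = j].
    have [->|si] := eqVneq s i; first by constructor 2.
    by have [->|sj] := eqVneq s j; [constructor 3|constructor 1; apply: others].
  case: (big k) (big l) => [->|Ek|Ek] [->|El|El]; rewrite ?Ek ?El ?eqxx ?orbT in npair kl *;
  by [left|right|].
pose u := pair_mnm a i j.
have [le|gt] := leqP (a i + a j) d; last first.
  apply: eq_reg (regr d); apply: eq_edge_mons => k l; rewrite rE /low_edge /=.
  have [ekl|//] := boolP (e k l); rewrite andbC /=.
  case: leqP => //= ld; apply/norP; split; apply/andP => -[/eqP ki /eqP lj];
  by move: ld; rewrite ki lj leqNgt ?gt // addnC gt.
apply: (@eq_reg _ _ (fun x => edge_mons a (r d) x || (u <= x)%MM)).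
  move=> x; rewrite pair_mnm_le //.
  apply/orP/edge_monsP => [[/edge_monsP[k [l [rkl ak al]]]|/andP[xi xj]]|].
  - by exists k, l; split=> //; move: rkl; rewrite rE /low_edge /= => /andP[/andP[-> _]].
  - by exists i, j; rewrite /low_edge /= eij.
  move=> [k [l [/andP[ekl kld] ak al]]].
  have [|nkl] := boolP ((k == i) && (l == j) || (k == j) && (l == i)).
    by case/orP=> /andP[/eqP Ek /eqP El]; right; rewrite -Ek -El ak al.
  by left; apply/edge_monsP; exists k, l; split=> //; rewrite rE ekl nkl.
apply: reg_add_gen => //; first exact: edge_mons_up.
  by rewrite mdeg_pair_mnm.
move=> x /edge_monsP[k [l [rkl ak al]]].
have out t : t != i -> t != j -> a t <= (u + x)%MM t -> 0 < x t.
  move=> ti tj; rewrite /u mnmDE pair_mnmE ![_ == t]eq_sym (negbTE ti) (negbTE tj).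
  exact: leq_trans.
have lightr s t : a s = 1 -> e t s -> s != i -> s != j -> (t == i) || (t == j) -> r d t s.
  move=> as1 ets si sj tij; rewrite rE ets (negbTE si) (negbTE sj) !andbF as1 /=.
  by case/orP: tij => /eqP->; lia.
(* The colon ideal by [u] is generated by the variables of the neighbours of [i] or [j] other than
   these two. *)
have new s : s != i -> s != j -> e i s || e j s -> a s <= (u + x)%MM s ->
    exists2 t, 0 < x t & edge_mons a (r d) (u + U_(t))%MM.
  move=> si sj es xs; exists s; first exact: out.
  have as1 := others s si sj.
  have us : a s <= (u + U_(s))%MM s by rewrite mnmDE mnm1E eqxx as1 addn1.
  apply/edge_monsP; case/orP: es => es; [exists i, s|exists j, s]; split=> //.
  - by apply: lightr; rewrite ?eqxx.
  - by rewrite mnmDE; apply: leq_trans (leq_addr _ _); apply: pair_mnm_gel.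
  - by apply: lightr; rewrite ?eqxx ?orbT.
  - by rewrite mnmDE; apply: leq_trans (leq_addr _ _); apply: pair_mnm_ger.
move: rkl; rewrite rE => /andP[/andP[ekl]]; rewrite negb_or => /andP[nkl1 nkl2] _.
have [ki|ki] := eqVneq k i.
  apply: (new l) => //; rewrite -?ki ?ekl //; first by rewrite eq_sym (edge_neq e_irr ekl).
  by move: nkl1; rewrite ki eqxx.
have [kj|kj] := eqVneq k j.
  apply: (new l) => //; rewrite -?kj ?ekl ?orbT //; last by rewrite eq_sym (edge_neq e_irr ekl).
  by move: nkl2; rewrite kj eqxx.
have [li|li] := eqVneq l i; first by apply: (new k); rewrite // -li e_sym ekl.
have [lj|lj] := eqVneq l j; first by apply: (new k); rewrite // -lj [e l k]e_sym ekl orbT.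
(* An edge disjoint from [i j] has an end adjacent to [i] or [j], whose variable absorbs it. *)
have := two_K2_free e_sym e_irr e_chordal eij ekl ki kj li lj.
case/or4P => es; [apply: (new k)|apply: (new l)|apply: (new k)|apply: (new l)];
  by rewrite ?es ?orbT.
Qed.
End Sufficiency.

(** * Necessity *)

Section Obstructions.
Variables (K : fieldType) (n : nat) (e : rel 'I_n) (a : 'I_n -> nat).
Hypotheses (e_sym : symmetric e) (e_irr : irreflexive e) (a_pos : forall i, 0 < a i).
Implicit Types (A V C : {set 'I_n}) (i j k l p q s t : 'I_n).

Definition vertex_mnm V : 'X_{1..n} := [multinom (p \in V) * a p | p < n].

Lemma mdeg_vertex_mnm V : mdeg (vertex_mnm V) = \sum_(p in V) a p.
Proof.
rewrite mdegE [RHS]big_mkcond; apply: eq_bigr => p _; rewrite mnmE.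
by case: (p \in V); rewrite ?mul1n.
Qed.

(** Removing [A] leaves exponent a_p - 1 at each [p] in [A], so the surviving generators are those
    of edges inside [V :\: A]. *)
Lemma vertex_faceP d V A : reflect
  [/\ A \subset V, d + #|A| <= \sum_(p in V) a p &
    exists p q, [/\ p \in V :\: A, q \in V :\: A, e p q & a p + a q <= d]]
  (face (component_mons e a d) (vertex_mnm V) A).
Proof.
have leA : (mesym1 A <= vertex_mnm V)%MM = (A \subset V).
  apply/mnm_lepP/subsetP => [H p pA|AV p]; last first.
    by rewrite !mnmE; case: (boolP (p \in A)) => // /AV ->; rewrite mul1n.
  by have := H p; rewrite !mnmE pA; case: (p \in V).
have deg : A \subset V ->
    (d <= mdeg (vertex_mnm V - mesym1 A)%MM) = (d + #|A| <= \sum_(p in V) a p).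
  rewrite -leA -mdeg_vertex_mnm => le; have := mdegD (vertex_mnm V - mesym1 A) (mesym1 A).
  by rewrite submK // mdeg_mesym1 => ->; rewrite leq_add2r.
have full p : (a p <= (vertex_mnm V - mesym1 A)%MM p) = (p \in V :\: A).
  rewrite mnmBE !mnmE inE; have := a_pos p.
  by case: (p \in V); case: (p \in A) => /=; lia.
rewrite /face leA; apply: (iffP andP) => [[AV /andP[]]|[AV dA [p [q [pV qV epq pqd]]]]].
  rewrite deg // => dA /edge_monsP[p [q [/andP[epq pqd]]]].
  by rewrite !full => pV qV; split=> //; exists p, q.
split=> //; apply/andP; split; first by rewrite deg.
by apply/edge_monsP; exists p, q; rewrite !full; split=> //; apply/andP.
Qed.

Hypothesis cwl : componentwise_linear (ideal_bracket a (edge_ideal K e)).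

(** The case p = 1 of linearity, where only total degree [d.+1] may carry homology, against
    [disconnected_not_acyclic]. *)
Lemma cwl_connected d V C s0 t0 : \sum_(p in V) a p <> d.+1 ->
  face (component_mons e a d) (vertex_mnm V) [set s0] ->
  face (component_mons e a d) (vertex_mnm V) [set t0] ->
  s0 \in C -> t0 \notin C ->
  exists s t, [/\ s \in C, t \notin C &
    face (component_mons e a d) (vertex_mnm V) [set s; t]].
Proof.
move=> degV fs ft sC tC.
have [/existsP[s /existsP[t /and3P[]]]|none] := boolP [exists s, exists t,
  [&& s \in C, t \notin C & face (component_mons e a d) (vertex_mnm V) [set s; t]]].
  by exists s, t.
case: (@disconnected_not_acyclic K n _ C s0 t0 fs ft sC tC) => [s t sC' tC'|].
  apply: contra none => f; apply/existsP; exists s; apply/existsP; exists t.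
  by rewrite sC' tC'.
by apply: (componentwise_linearP K a e_irr).1 => //; rewrite mdeg_vertex_mnm.
Qed.

(* When [a i <= a j], the vertex [i] is isolated in the complex of the component
   of degree [a j + a k] in multidegree x_i^(a i) x_j^(a j) x_k^(a k). *)
Lemma cwl_no_common_nbr i j k : i != j -> 1 < a i -> 1 < a j -> e i k -> ~~ e j k.
Proof.
wlog le_ij : i j / a i <= a j => [H ij ai aj eik|].
  have [le|/ltnW le] := leqP (a i) (a j); first exact: (H i j).
  by apply: contraL eik => ejk; apply: (H j i) => //; rewrite eq_sym.
move=> ij ai _ eik; apply/negP => ejk.
have ik := edge_neq e_irr eik; have jk := edge_neq e_irr ejk.
pose V := [set i; j; k]; pose d := a j + a k.
have sumV : \sum_(p in V) a p = a i + d.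
  rewrite /V -setUA big_setU1 ?inE ?negb_or ?ij //= big_setU1 ?inE //=.
  by rewrite big_set1.
have face1 s p q : s \in V -> p \in V -> q \in V -> p != s -> q != s -> e p q ->
    a p + a q <= d -> face (component_mons e a d) (vertex_mnm V) [set s].
  move=> sV pV qV ps qs epq le; apply/vertex_faceP; split.
  - by rewrite sub1set.
  - by rewrite cards1 sumV addnC leq_add2r.
  - by exists p, q; rewrite !in_setD !in_set1 ps qs.
(* The face of [i] comes from the edge [j k] of weight [d], that of [j] from [i k]; the total degree
   [a i + d] is not [d.+1] since [a i > 1]. *)
have [|||||s [t [/set1P -> ti]]] := @cwl_connected d V [set i] i j.
- by rewrite sumV -add1n => /addIn ai1; rewrite ai1 in ai.
- by apply: (face1 i j k); rewrite ?inE ?eqxx ?orbT // eq_sym.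
- by apply: (face1 j i k); rewrite ?inE ?eqxx ?orbT // 1?eq_sym // leq_add2r.
- by rewrite inE.
- by rewrite inE eq_sym.
case/vertex_faceP=> /subsetP tV _ [p [q [pV qV epq _]]].
(* A face containing [i] and one of [j], [k] leaves a single vertex of [V], too few for an edge. *)
suff pq : p = q by rewrite pq e_irr in epq.
have Vjk r : r \in V -> r != i -> (r == j) || (r == k).
  by rewrite !inE -orbA => /orP[->|].
move: pV qV; rewrite !in_setD !in_set2 !negb_or.
case/andP=> /andP[pi pt] /Vjk/(_ pi) pjk /andP[/andP[qi qt] /Vjk/(_ qi) qjk].
have tjk : (t == j) || (t == k).
  by apply: Vjk; [apply: tV; rewrite set22|move: ti; rewrite inE].
move: pt qt; case/orP: tjk => /eqP->; case/orP: pjk => /eqP->; case/orP: qjk => /eqP->;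
by rewrite ?eqxx.
Qed.

(* When [a i <= a j], in the multidegree of the path the complex of the
   component of degree [a j + 1] is the disjoint union of the segments [k i]
   and [j l]. *)
Lemma cwl_no_path k i j l : e k i -> e i j -> e j l -> 1 < a i -> 1 < a j ->
  a k = 1 -> a l = 1 -> ~~ e k j -> ~~ e i l -> k != l -> e k l.
Proof.
wlog le_ij : k i j l / a i <= a j => [H eki eij ejl ai aj ak al nkj nil kl|].
  have [le|/ltnW le] := leqP (a i) (a j); first exact: (H k i j l).
  by rewrite e_sym; apply: (H l j i k); rewrite // 1?eq_sym // e_sym.
move=> eki eij ejl ai _ ak al nkj nil kl; apply: contraT => nkl.
have ki := edge_neq e_irr eki; have ij := edge_neq e_irr eij; have jl := edge_neq e_irr ejl.
have kj : k != j by apply: contraNneq nkl => ->.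
have il : i != l by apply: contraNneq nkl => <-.
(* This [d] admits the edges [k i] and [j l] but not [i j], since [a i > 1]. *)
pose V := k |: (i |: [set j; l]); pose d := (a j).+1.
have sumV : \sum_(p in V) a p = (a i + d).+1.
  by rewrite /V !big_setU1 ?big_set1 ?inE ?negb_or ?ki ?kj ?kl ?ij ?il //= ak al addn1 add1n.
have face1 s p q : s \in V -> p \in V -> q \in V -> p != s -> q != s -> e p q ->
    a p + a q <= d -> face (component_mons e a d) (vertex_mnm V) [set s].
  move=> sV pV qV ps qs epq le; apply/vertex_faceP; split.
  - by rewrite sub1set.
  - by rewrite cards1 sumV addn1 ltnS leq_addl.
  - by exists p, q; rewrite !in_setD !in_set1 ps qs.
have [|||||s [t [sC tC]]] := @cwl_connected d V [set k; i] k j.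
- by rewrite sumV => -[]; rewrite -[RHS]add0n => /addIn ai0; rewrite ai0 in ai.
- by apply: (face1 k j l); rewrite ?inE ?eqxx ?orbT // 1?eq_sym // al addn1.
- by apply: (face1 j k i); rewrite ?inE ?eqxx ?orbT // ak add1n.
- by rewrite !inE eqxx.
- by rewrite !inE negb_or eq_sym kj eq_sym ij.
(* A crossing face leaves one vertex on each side, and the only cross edge, [i j], is too heavy. *)
case/vertex_faceP=> /subsetP tV _ [p [q [pV qV epq le]]].
have part r : r \in V -> ((r == k) || (r == i)) || ((r == j) || (r == l)).
  by rewrite !inE !orbA.
have tjl : (t == j) || (t == l).
  have /part := tV t (set22 s t); move: tC; rewrite !inE negb_or.
  by case/andP=> /negbTE-> /negbTE->.
have ki_only r r' : r \in [set k; i] -> r' \in [set k; i] ->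
     r != s -> r' != s -> r = r'.
  move: sC; rewrite !inE => /orP[]/eqP-> /orP[]/eqP-> /orP[]/eqP->;
  by rewrite ?eqxx.
have jl_only r r' : (r == j) || (r == l) -> (r' == j) || (r' == l) ->
     r != t -> r' != t -> r = r'.
  by case/orP: tjl => /eqP-> /orP[]/eqP-> /orP[]/eqP->; rewrite ?eqxx.
have cross r r' : (r == k) || (r == i) -> (r' == j) || (r' == l) -> e r r' ->
    a r + a r' <= d -> False.
  case/orP=> /eqP-> /orP[]/eqP->; rewrite ?(negbTE nkj) ?(negbTE nkl) ?(negbTE nil) //.
  by move=> _; rewrite /d -add1n leq_add2r leqNgt ai.
move: pV qV; rewrite !in_setD !in_set2 !negb_or.
case/andP=> /andP[ps pt] pV /andP[/andP[qs qt] qV].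
case/orP: (part p pV) => pp; case/orP: (part q qV) => qq.
- by move: epq; rewrite (ki_only p q) ?in_set2 // e_irr.
- by case: (cross p q).
- by case: (cross q p); rewrite // 1?e_sym // addnC.
- by move: epq; rewrite (jl_only p q) // e_irr.
Qed.

End Obstructions.

(** * The characterization of componentwise linearity *)

Theorem theorem3p9 (K : fieldType) (n : nat) (e : rel 'I_n) (a : 'I_n -> nat)
    (e_sym : symmetric e) (e_irr : irreflexive e)
    (e_conn : connected e) (e_noiso : forall i, exists j, e i j)
    (e_chordal : chordal (compl_graph e))
    (a_pos : forall i, (0 < a i)%N) :
  componentwise_linear (ideal_bracket a (edge_ideal K e)) <->
  [\/ (#|[set i | (1 < a i)%N]| <= 1)%N,
      independent e [set i | (2 <= a i)%N] /\
        (forall i j, (2 <= a i)%N -> (2 <= a j)%N -> i != j ->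
           nbhd e i :&: nbhd e j = set0)
    | exists i j,
        [/\ i != j, [set k | (1 < a k)%N] = [set i; j],
            e i j,
            nbhd e i :&: nbhd e j = set0
          & forall k l, k \in nbhd e i -> l \in nbhd e j -> e k l]].
Proof.
have nbhdI i j : nbhd e i :&: nbhd e j = set0 <-> forall k, e i k -> ~~ e j k.
  split=> [/setP E k eik|E]; first by have := E k; rewrite !inE eik /= => ->.
  by apply/setP => k; rewrite !inE; apply/andP => -[/E/negbTE->].
split=> [cwl|[card1|[ind disj]|[i [j [ij Vij eij /nbhdI disj full]]]]].
- have common := cwl_no_common_nbr e_irr a_pos cwl.
  have [/existsP[i /existsP[j /and3P[ai aj eij]]]|none] :=
    boolP [exists i, exists j, [&& 1 < a i, 1 < a j & e i j]]; last first.
    constructor 2; split=> [i j|i j ai aj ij].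
      rewrite !inE => ai aj _; apply: contra none => eij.
      by apply/existsP; exists i; apply/existsP; exists j; rewrite ai aj.
    by apply/nbhdI => k; apply: common.
  have ij := edge_neq e_irr eij.
  (* A third vertex [k] of weight at least 2 is adjacent to neither [i] nor [j]. For a neighbour [m]
     of [k], [two_K2_free] makes [m] adjacent to [i] or [j], hence a forbidden common neighbour. *)
  have only k : k != i -> k != j -> a k = 1.
    move=> ki kj; apply/eqP; rewrite eqn_leq a_pos andbT leqNgt; apply/negP => ak.
    have nki : ~~ e k i by apply: (common j k); rewrite // 1?eq_sym // e_sym.
    have nkj : ~~ e k j by apply: (common i k); rewrite // eq_sym.
    have [m ekm] := e_noiso k.
    have mi : m != i by apply: contraNneq nki => <-.
    have mj : m != j by apply: contraNneq nkj => <-.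
    have := two_K2_free e_sym e_irr e_chordal eij ekm ki kj mi mj.
    rewrite [e i k]e_sym [e j k]e_sym (negbTE nki) (negbTE nkj) /=.
    by rewrite (negbTE (common k i m _ _ _ _)) // (negbTE (common k j m _ _ _ _)).
  constructor 3; exists i, j; split=> //.
  + apply/setP => k; rewrite !inE; have [->|ki] := eqVneq k i; first by rewrite ai.
    by have [->|kj] := eqVneq k j; rewrite ?aj // only.
  + by apply/nbhdI => k; apply: common.
  move=> k l; rewrite !inE => eik ejl.
  have [->//|kj] := eqVneq k j; have [->|li] := eqVneq l i; first by rewrite e_sym.
  have njk := common i j k ij ai aj eik.
  have nil : ~~ e i l by apply: common ejl; rewrite // eq_sym.
  have ki : k != i by rewrite eq_sym (edge_neq e_irr eik).
  have lj : l != j by rewrite eq_sym (edge_neq e_irr ejl).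
  have kl : k != l by apply: contraNneq njk => ->.
  (* Were [k l] missing, [k - i - j - l] would be an induced path with ends of weight 1. *)
  apply: (cwl_no_path e_sym e_irr a_pos cwl (i := i) (j := j)) => //.
  + by rewrite e_sym.
  + exact: only.
  + exact: only.
  + by rewrite e_sym.
(* Under (A) no two distinct vertices have weight at least 2. *)
- apply: cwl_sparse => //.
  have eq i j : 1 < a i -> 1 < a j -> i = j.
    by move=> ai aj; apply: (card_le1_eqP card1); rewrite inE.
  split=> [i j _ _ ai aj|i j k _ _ _ ai aj]; first by rewrite (eq i j) // e_irr.
  by rewrite (eq i j) ?eqxx.
- apply: cwl_sparse => //; split=> [i j _ _ ai aj|i j k _ _ _ ai aj ij].
    by have [->|ij] := eqVneq i j; [rewrite e_irr|apply: ind; rewrite ?inE].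
  by apply/negP => /andP[eik]; apply/negP/((nbhdI i j).1 (disj i j ai aj ij)).
have inV k : (1 < a k) = (k == i) || (k == j).
  by have /setP/(_ k) := Vij; rewrite !inE.
apply: (cwl_pair K e_sym e_irr e_chordal a_pos eij); rewrite ?inV ?eqxx ?orbT //.
- move=> k ki kj; have := inV k; rewrite (negbTE ki) (negbTE kj).
  by have := a_pos k; lia.
- by move=> k /disj/negP.
- by move=> k l eik ejl; apply: full; rewrite inE.
Qed.
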